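(* If $G$ is a graph of order $n$ (that is, with $n$ vertices) with at most $2n-3$ edges, then $G$ has a stable cutset or belongs to the class ${\cal G}_{sc}$.
   Context: All graphs are finite, simple, and undirected. A stable set is a set of pairwise non-adjacent vertices. A stable cutset in a graph $G$ is a stable set $S$ of vertices of $G$ for which $G-S$ (the graph obtained by deleting the vertices in $S$) is disconnected. For graphs $G$ and $H$ (whose vertex sets may overlap), $G\cup H$ is the graph with vertex set $V(G)\cup V(H)$ and edge set $E(G)\cup E(H)$, and $G\cap H$ is the graph with vertex set $V(G)\cap V(H)$ and edge set $E(G)\cap E(H)$. $K_m$ is the complete graph on $m$ vertices, and $\overline{C_6}$ is the complement of the cycle of length $6$, i.e. the triangular prism (two disjoint triangles joined by a perfect matching of three edges). The class ${\cal G}_{sc}$ of graphs (considered up to isomorphism) is defined recursively as follows: (1) $K_3,\overline{C_6}\in {\cal G}_{sc}$; (2) if $G,H\in {\cal G}_{sc}$ and $G\cap H$ is isomorphic to $K_2$ or $K_3$, then $G\cup H\in {\cal G}_{sc}$.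
   Formalization: The graph K_2 is excluded: it has n = 2 vertices and 1 = 2n − 3 edge, has no stable cutset, and is not in the class, since every member has at least 3 vertices; the statement is proved for every other graph. *)

(* Defs.v *)
From mathcomp Require Import all_boot.
Set Implicit Arguments.
Unset Strict Implicit.
Unset Printing Implicit Defensive.

(* Vertex sets are subsets of an ambient finite type, so that two graphs over
   the same T may overlap and be united or intersected literally.  An edge is the set of its two ends. *)
Record graph (T : finType) := Graph {
  vertices : {set T};
  edges : {set {set T}};
  edgesP : {in edges, forall e : {set T}, e \subset vertices /\ #|e| = 2} }.

Section Basics.
Variable T : finType.
Implicit Types (G H : graph T) (S : {set T}).

Definition adj G : rel T := [rel x y | [set x; y] \in edges G].

Lemma graph_on_subproof (V : {set T}) (P : pred {set T}) :
  {in [set e : {set T} | [&& e \subset V, #|e| == 2 & P e]],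
    forall e : {set T}, e \subset V /\ #|e| = 2}.
Proof. by move=> e; rewrite inE => /and3P[-> /eqP]. Qed.

Definition graph_on (V : {set T}) (P : pred {set T}) : graph T :=
  Graph (@graph_on_subproof V P).

Definition complement G := graph_on (vertices G) (fun e => e \notin edges G).

Definition delete G S := graph_on (vertices G :\: S) (fun e => e \in edges G).

Lemma union_subproof G H :
  {in edges G :|: edges H, forall e : {set T},
    e \subset vertices G :|: vertices H /\ #|e| = 2}.
Proof.
move=> e /setUP[] /edgesP[sub card2]; split=> //; apply: subset_trans sub _.
- exact: subsetUl.
- exact: subsetUr.
Qed.

Definition union G H : graph T := Graph (@union_subproof G H).

Lemma inter_subproof G H :
  {in edges G :&: edges H, forall e : {set T},
    e \subset vertices G :&: vertices H /\ #|e| = 2}.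
Proof.
by move=> e /setIP[/edgesP[sG card2] /edgesP[sH _]]; rewrite subsetI sG sH.
Qed.

Definition inter G H : graph T := Graph (@inter_subproof G H).

Definition stable G S :=
  S \subset vertices G /\ {in S &, forall x y, ~~ adj G x y}.

(* The graph with no vertex counts as connected. *)
Definition connected G :=
  {in vertices G &, forall x y, connect (adj G) x y}.

Definition stable_cutset G S := stable G S /\ ~ connected (delete G S).

End Basics.

Definition complete m : graph 'I_m := graph_on [set: 'I_m] predT.

(* ordS is the cyclic successor i |-> i + 1 mod m *)
Definition cycle_graph m : graph 'I_m :=
  graph_on [set: 'I_m] (fun e => e \in [set [set i; ordS i] | i : 'I_m]).

Definition isomorphic (T U : finType) (G : graph T) (H : graph U) : Prop :=
  exists2 f : {x | x \in vertices G} -> {y | y \in vertices H},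
    bijective f & forall x y, adj H (val (f x)) (val (f y)) = adj G (val x) (val y).

(* T varies so that the class is closed under isomorphism, including between
   graphs living in different ambient types. *)
Inductive Gsc : forall T : finType, graph T -> Prop :=
| Gsc_K3 : Gsc (complete 3)
| Gsc_prism : Gsc (complement (cycle_graph 6)) (* the triangular prism *)
| Gsc_union (T : finType) (G H : graph T) :
    Gsc G -> Gsc H ->
    isomorphic (inter G H) (complete 2) \/ isomorphic (inter G H) (complete 3) ->
    Gsc (union G H)
| Gsc_iso (T U : finType) (G : graph T) (H : graph U) :
    isomorphic G H -> Gsc G -> Gsc H.

(* Main.v *)
Require Import Defs.
From mathcomp Require Import all_boot zify.
Set Implicit Arguments.
Unset Strict Implicit.
Unset Printing Implicit Defensive.

(* Call a vertex set solid if the graph it induces has no stable cutset, and argue by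
   induction on a solid graph with at most [2n - 3] edges.

   A counting theorem in the style of Chen and Yu ([chen_yu]) yields a nonempty set
   with stable neighbourhood avoiding a prescribed set [M] as soon as the edges and
   [M] together number at most [2|Z| - 2].  It bounds the edges inside [U] by
   [2|U| - 3], and a graph with a separating clique splits into two solid pieces.
   Otherwise proper sets with at least four vertices have at most [2|U| - 4] edges.
   In such a sparse graph an uncrossing argument ([separation]) separates any two
   nonadjacent vertices of a proper induced subgraph by a stable set.  It follows that
   a vertex [x] of degree 3 lies in a triangle [xyz] and that its third neighbour [w]
   has degree 3 and lies in a triangle [wpq].

   If some edge joins [{y, z}] to [{p, q}], separation produces the matching edge and
   the graph is the prism.  If not, no stable set separates [y] from [{p, q}] in
   [G - x - w - z] ([no_far_region]), so the hypothesis of [separation] fails at some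
   tight set, containing [y], [p], [q] but not [z], with [2|X| - 4] edges.  The four
   tight sets obtained by symmetry pairwise cover almost everything, which leaves at
   most eight vertices and too few edges. *)

(** * Isomorphisms *)

Lemma isomorphic_map (T U : finType) (G : graph T) (H : graph U) (g : T -> U) :
    {in vertices G &, injective g} -> g @: vertices G = vertices H ->
    {in vertices G &, forall x y, adj H (g x) (g y) = adj G x y} -> isomorphic G H.
Proof.
move=> ginj gim gadj.
have gV (u : {x | x \in vertices G}) : g (val u) \in vertices H.
  by rewrite -gim imset_f // (valP u).
exists (fun u => Sub (g (val u)) (gV u)); last first.
  by move=> u v; rewrite !SubK gadj ?(valP u) ?(valP v).
apply: inj_card_bij => [u v /(congr1 val)|].
  by rewrite !SubK => /ginj E; apply: val_inj; apply: E; rewrite (valP u, valP v).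
by rewrite !card_sig -gim card_in_imset.
Qed.

Lemma isomorphic_sym (T U : finType) (G : graph T) (H : graph U) :
  isomorphic G H -> isomorphic H G.
Proof.
move=> [f [g fK gK] fadj]; exists g; first by exists f.
by move=> x y; rewrite -{2}(gK x) -{2}(gK y) fadj.
Qed.

Lemma isomorphic_eq (T : finType) (G H : graph T) : vertices G = vertices H ->
  {in vertices G &, forall x y, adj H x y = adj G x y} -> isomorphic G H.
Proof.
move=> VE adjE; apply: (@isomorphic_map _ _ _ _ id) => //.
by rewrite -VE imset_id.
Qed.

Lemma isomorphic_complete (T : finType) (G : graph T) k : #|vertices G| = k ->
  {in vertices G &, forall x y, adj G x y = (x != y)} -> isomorphic (complete k) G.
Proof.
move=> cG adjE; pose g (i : 'I_k) := enum_val (cast_ord (esym cG) i).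
have gV i : g i \in vertices G by apply: enum_valP.
have ginj : injective g by move=> i j /enum_val_inj/cast_ord_inj.
apply: (@isomorphic_map _ _ _ _ g) => [i j _ _||i j _ _]; first exact: ginj.
  apply/eqP; rewrite eqEcard (card_imset _ ginj) cardsT card_ord cG leqnn andbT.
  by apply/subsetP => x /imsetP[i _ ->].
rewrite adjE // (inj_eq ginj) /adj /= inE subsetT cards2 andbT /=.
by case: (_ != _).
Qed.

Lemma adj_prism (i j : 'I_6) :
  adj (complement (cycle_graph 6)) i j = [&& i != j, j != ordS i & i != ordS j].
Proof.
rewrite /adj /= inE subsetT cards2 /=; have [->//|ij] /= := eqVneq i j.
rewrite inE subsetT cards2 ij /= -negb_or; congr negb.
apply/imsetP/orP => [[k _ E]|[/eqP E|/eqP E]].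
- have /set2P ik : i \in [set k; ordS k] by rewrite -E set21.
  have /set2P jk : j \in [set k; ordS k] by rewrite -E set22.
  by case: ik ij => ->; case: jk => ->; rewrite ?eqxx //; [left|right].
- by exists i => //; rewrite -E.
- by exists j => //; rewrite -E setUC.
Qed.

(** * Counting edges *)

(* [lia] is exponential in the boolean hypotheses in context, so they are dropped. *)
Ltac nlia := repeat match goal with
  | H : is_true (leq _ _) |- _ => revert H
  | H : @eq nat _ _ |- _ => revert H end; clear; intros; lia.

Section EdgeCounts.
Variables (T : finType) (e : rel T).
Hypotheses (eC : symmetric e) (e0 : irreflexive e).
Implicit Types (x y z v w p q : T) (X Y Z U V W M N O P Q A B C D R S : {set T}).

Definition nb Z Q := [set y in Z :\: Q | [exists x in Q, e x y]].
Definition stb S := [forall x in S, forall y in S, ~~ e x y].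
(* Ordered pairs: an edge inside [X] is counted twice in [dd X X]. *)
Definition dd X Y := \sum_(x in X) \sum_(y in Y) (e x y : nat).
Definition ne X := (dd X X)./2.

Lemma nbP Z Q y :
  reflect [/\ y \in Z, y \notin Q & exists2 x, x \in Q & e x y] (y \in nb Z Q).
Proof.
rewrite inE inE; apply: (iffP andP) => [[/andP[yQ yZ] /exists_inP[x xQ xy]]|].
  by split=> //; exists x.
by case=> yZ yQ [x xQ xy]; rewrite yQ yZ; split=> //; apply/exists_inP; exists x.
Qed.

Lemma stbP S : reflect {in S &, forall x y, ~~ e x y} (stb S).
Proof.
apply: (iffP idP) => [/forall_inP h x y xS|h]; first exact: (forall_inP (h _ xS)).
by apply/forall_inP => x xS; apply/forall_inP => y; apply: h.
Qed.

Lemma stbPn S : ~~ stb S -> exists x y, [/\ x \in S, y \in S & e x y].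
Proof.
rewrite negb_forall_in => /exists_inP[x xS].
rewrite negb_forall_in => /exists_inP[y yS]; rewrite negbK => xy.
by exists x, y.
Qed.

Lemma stbS S S' : S \subset S' -> stb S' -> stb S.
Proof.
by move=> /subsetP sS /stbP h; apply/stbP => x y /sS xS /sS; apply: h.
Qed.

Lemma dd0l X : dd set0 X = 0.
Proof. by rewrite /dd big_set0. Qed.

Lemma ddC X Y : dd X Y = dd Y X.
Proof.
rewrite /dd exchange_big; apply: eq_bigr => y _.
by apply: eq_bigr => x _; rewrite eC.
Qed.

Lemma dd0r X : dd X set0 = 0.
Proof. by rewrite ddC dd0l. Qed.

Lemma ddUl X Y Z : [disjoint X & Y] -> dd (X :|: Y) Z = dd X Z + dd Y Z.
Proof.
by move=> dXY; rewrite /dd -bigU //; apply: eq_bigl => x; rewrite !inE.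
Qed.

Lemma ddUr X Y Z : [disjoint X & Y] -> dd Z (X :|: Y) = dd Z X + dd Z Y.
Proof. by move=> dXY; rewrite ddC ddUl // ddC (ddC Y). Qed.

Lemma dd1E v X : dd [set v] X = #|[set y in X | e v y]|.
Proof.
rewrite /dd big_set1.
have -> : #|[set y in X | e v y]| = \sum_(y in X | e v y) 1.
  by rewrite -sum1_card; apply: eq_bigl => y; rewrite inE.
by rewrite big_mkcondr; apply: eq_bigr => y _; case: (e v y).
Qed.

Lemma dd11 x y : dd [set x] [set y] = e x y.
Proof. by rewrite /dd !big_set1. Qed.

Lemma dd_eq0 X Y : {in X & Y, forall x y, ~~ e x y} -> dd X Y = 0.
Proof.
move=> h; rewrite /dd big1 // => x xX; rewrite big1 // => y yY.
by rewrite (negPf (h _ _ xX yY)).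
Qed.

Lemma dd_gt0 X Y x y : x \in X -> y \in Y -> e x y -> 0 < dd X Y.
Proof.
move=> xX yY xy; rewrite /dd (bigD1 x) //= (bigD1 y) //= xy; lia.
Qed.

Lemma dd_sub X Y X' Y' : X \subset X' -> Y \subset Y' -> dd X Y <= dd X' Y'.
Proof.
move=> sX sY.
have dX : [disjoint X & X' :\: X] by rewrite -setI_eq0 setIDA setDIl setDv set0I.
have dY : [disjoint Y & Y' :\: Y] by rewrite -setI_eq0 setIDA setDIl setDv set0I.
have UD (A A' : {set T}) : A \subset A' -> A' = A :|: (A' :\: A).
  by move=> /setIidPr sA; rewrite -{1}(setID A' A) sA.
by rewrite (UD _ _ sX) (UD _ _ sY) ddUl // !ddUr // -addnA leq_addr.
Qed.

Lemma dd_even X : dd X X = (ne X).*2.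
Proof.
suff : ~~ odd (dd X X) by rewrite /ne; lia.
have [n] := ubnP #|X|; elim: n X => // n IH X.
have [->|[v vX]] := set_0Vmem X; first by rewrite dd0l.
rewrite (cardsD1 v) vX ltnS => ltX.
have dv : [disjoint [set v] & X :\ v] by rewrite disjoints1 !inE eqxx.
have := IH _ ltX; rewrite -{3 4}(setD1K vX) ddUl // !ddUr // (ddC (X :\ v)) dd11 e0.
by lia.
Qed.

Lemma neU X Y : [disjoint X & Y] -> ne (X :|: Y) = ne X + ne Y + dd X Y.
Proof.
move=> dXY; have := dd_even (X :|: Y).
by rewrite ddUl // !ddUr // (ddC Y X) !dd_even; lia.
Qed.

Lemma ne1 v : ne [set v] = 0.
Proof. by rewrite /ne dd11 e0. Qed.

Lemma ne0 : ne set0 = 0.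
Proof. by rewrite /ne dd0l. Qed.

Lemma neD1 v X : v \in X -> ne X = ne (X :\ v) + dd [set v] (X :\ v).
Proof.
move=> vX; rewrite -{1}(setD1K vX) neU ?ne1 //.
by rewrite disjoints1 !inE eqxx.
Qed.

Lemma neU1 v X : v \notin X -> ne (v |: X) = ne X + dd [set v] X.
Proof. by move=> vX; rewrite neU ?ne1 // disjoints1. Qed.

Lemma disjID X Y : [disjoint X :&: Y & X :\: Y].
Proof. by rewrite -setI_eq0; apply/eqP/setP => x; rewrite !inE; do 2 case: (_ \in _). Qed.

Lemma disjDr X Y : [disjoint X & Y :\: X].
Proof. by rewrite -setI_eq0; apply/eqP/setP => x; rewrite !inE; do 2 case: (_ \in _). Qed.

Lemma disjDD X Y : [disjoint X :\: Y & Y :\: X].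
Proof. by rewrite -setI_eq0; apply/eqP/setP => x; rewrite !inE; do 2 case: (_ \in _). Qed.

Lemma neID X Y : ne X = ne (X :&: Y) + ne (X :\: Y) + dd (X :&: Y) (X :\: Y).
Proof. by rewrite -neU ?disjID // setID. Qed.

(** The edges between [X :\: Y] and [Y :\: X] are the only ones that the union gains. Every
    uncrossing argument below rests on this identity. *)
Lemma ne_supermod X Y :
  ne (X :|: Y) + ne (X :&: Y) = ne X + ne Y + dd (X :\: Y) (Y :\: X).
Proof.
have -> : X :|: Y = (X :&: Y) :|: ((X :\: Y) :|: (Y :\: X)).
  by apply/setP => x; rewrite !inE; do 2 case: (_ \in _).
have dI : [disjoint X :&: Y & (X :\: Y) :|: (Y :\: X)].
  by rewrite disjoints_subset; apply/subsetP => x; rewrite !inE; do 2 case: (_ \in _).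
rewrite neU // neU ?disjDD // ddUr ?disjDD // (neID X Y) (neID Y X) (setIC Y X).
by lia.
Qed.

Lemma stb_ne S : stb S = (ne S == 0).
Proof.
have -> : (ne S == 0) = (dd S S == 0) by rewrite dd_even; lia.
apply/stbP/eqP => [h|h x y xS yS]; first exact: dd_eq0.
by apply/negP => xy; have := dd_gt0 xS yS xy; rewrite h.
Qed.

Lemma dd_sum X Y : dd X Y = \sum_(x in X) dd [set x] Y.
Proof. by rewrite /dd; apply: eq_bigr => x _; rewrite big_set1. Qed.

Lemma nbS Z Q : nb Z Q \subset Z.
Proof. by apply/subsetP => y /nbP[]. Qed.

Lemma nb_disj Z Q : [disjoint Q & nb Z Q].
Proof.
rewrite disjoints_subset; apply/subsetP => y yQ; rewrite inE.
by apply/nbP => -[_]; rewrite yQ.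
Qed.

(** Connectedness by cuts rather than paths, which suits arguments by closed subsets. The empty set
    and singletons are connected. *)
Definition conn Z :=
  forall P, P \subset Z -> P != set0 -> P != Z -> nb Z P != set0.

Lemma connVcut Z : conn Z \/
  exists P, [/\ P \subset Z, P != set0, P != Z & nb Z P = set0].
Proof.
have [/existsP[P /and4P[? ? ? /eqP ?]]|/existsPn h] := boolP
  [exists P : {set T}, [&& P \subset Z, P != set0, P != Z & nb Z P == set0]].
  by right; exists P.
left=> P sP P0 PZ; apply/negP => /eqP n0.
by have := h P; rewrite sP P0 PZ n0 eqxx.
Qed.

Lemma nb0P Z Q : nb Z Q = set0 -> {in Q & Z :\: Q, forall x y, ~~ e x y}.
Proof.
move=> n0 x y xQ /setDP[yZ yQ]; apply/negP => xy.
have : y \in nb Z Q by apply/nbP; split=> //; exists x.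
by rewrite n0 inE.
Qed.

Lemma nb_eq0 Z Q : {in Q & Z :\: Q, forall x y, ~~ e x y} -> nb Z Q = set0.
Proof.
move=> h; apply/eqP; rewrite -subset0; apply/subsetP => y /nbP[yZ yQ [x xQ xy]].
by have := h x y xQ; rewrite inE yQ yZ xy => /(_ isT).
Qed.

(** A minimal set [C] containing [w] and closed under adjacency in [X] works: if [P] split it, then
    [P] or [C :\: P], whichever contains [w], would be a smaller such set. *)
Lemma component_exists X w : w \in X ->
  exists C, [/\ w \in C, C \subset X, conn C & nb X C = set0].
Proof.
move=> wX.
pose p (C : {set T}) := [&& w \in C, C \subset X & nb X C == set0].
have pX : p X.
  by rewrite /p wX subxx; apply/eqP/nb_eq0 => x y _; rewrite setDv inE.
have [C minC sCX] := minset_exists pX.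
have /and3P[wC sC /eqP nC] := minsetp minC.
exists C; split=> // P sP P0 PC; apply/negP => /eqP n0.
have hP := nb0P n0; have hC := nb0P nC.
have := minsetinf minC.
case: (boolP (w \in P)) => wP /=.
  move=> /(_ P) h; case/eqP: PC; apply: h => //; rewrite /p wP (subset_trans sP sC) /=.
  apply/eqP/nb_eq0 => x y xP /setDP[yX yP].
  have [yC|yC] := boolP (y \in C); first by apply: hP => //; rewrite inE yP.
  by apply: hC; [exact: (subsetP sP)|rewrite inE yC].
move=> /(_ (C :\: P)) h.
suff E : C :\: P = C.
  case/negP: P0; rewrite -subset0; apply/subsetP => x xP.
  by have := subsetP sP _ xP; rewrite -E inE xP.
apply: h; last exact: subsetDl.
rewrite /p inE wP wC (subset_trans (subsetDl _ _) sC) /=.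
apply/eqP/nb_eq0 => x y /setDP[xC xP] /setDP[yX]; rewrite inE negb_and negbK => yCP.
have [yC|yC] := boolP (y \in C); last by apply: hC => //; rewrite inE yC.
have yP : y \in P by move: yCP; rewrite yC orbF.
by rewrite eC; apply: hP => //; rewrite inE xP.
Qed.

Lemma nb_sub Z Q S : {in Q & Z :\: Q, forall x y, e x y -> y \in S} ->
  nb Z Q \subset S.
Proof.
by move=> h; apply/subsetP => y /nbP[yZ yQ [x xQ xy]]; apply: (h x) => //; rewrite inE yQ.
Qed.

Lemma disjointP X Y : (forall x, x \in X -> x \in Y -> False) -> [disjoint X & Y].
Proof.
move=> h; rewrite disjoints_subset; apply/subsetP => x xX; rewrite inE.
by apply/negP; apply: h.
Qed.

Lemma cardU X Y : [disjoint X & Y] -> #|X :|: Y| = #|X| + #|Y|.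
Proof. by move=> dXY; apply/eqP; rewrite (leq_card_setU X Y). Qed.

Lemma conn_closed Z P : conn Z -> P \subset Z -> P != set0 -> nb Z P = set0 -> P = Z.
Proof.
move=> cZ sP P0 nP; apply/eqP/negPn/negP => PZ.
by have := cZ P sP P0 PZ; rewrite nP eqxx.
Qed.

(** A closed part of [v |: P] that misses [v] is closed in [Z]; if it contains [v], its complement
    in [v |: P] is closed in [Z]. *)
Lemma conn_cut v Z P : conn Z -> v \in Z -> P \subset Z :\ v -> nb (Z :\ v) P = set0 ->
  conn (v |: P).
Proof.
move=> cZ vZ sP /nb0P hP X sX X0 XP; apply/negP => /eqP /nb0P hX.
have inP x : x \in P -> x \in Z /\ x != v.
  by move=> /(subsetP sP); rewrite !inE => /andP[].
have [vX|vX] := boolP (v \in X); last first.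
  have XZ : X \subset Z.
    apply/subsetP => x /(subsetP sX); rewrite !inE => /predU1P[->//|/inP[]//].
  suff E : X = Z by rewrite E vZ in vX.
  apply: conn_closed cZ XZ X0 _; apply: nb_eq0 => x y xX /setDP[yZ yX].
  have [yP|yP] := boolP (y \in v |: P); first by apply: hX; rewrite // inE yX.
  move: yP; rewrite !inE negb_or => /andP[yv yP].
  apply: hP; last by rewrite !inE yP yv.
  by have := subsetP sX x xX; rewrite !inE; case: eqP => // xv; rewrite -xv xX in vX.
have cX : (v |: P) :\: X \subset Z.
  apply/subsetP => x; rewrite !inE => /andP[_ /predU1P[->//|/inP[]//]].
suff E : (v |: P) :\: X = Z by have := vZ; rewrite -E !inE vX.
apply: conn_closed cZ cX _ _.
- rewrite setD_eq0; apply: contra XP => s; rewrite eqEsubset sX; exact: s.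
- apply: nb_eq0 => x y /setDP[xP xX] /setDP[yZ]; rewrite inE negb_and negbK => yXP.
  have [yX|yX] := boolP (y \in X); first by rewrite eC; apply: hX; rewrite // inE xX.
  move: yXP; rewrite (negPf yX) /= !inE negb_or => /andP[yv yP].
  apply: hP; last by rewrite !inE yP yv.
  by move: xP; rewrite !inE; case: eqP => // xv; rewrite xv vX in xX.
Qed.

(** * Stable neighbourhoods *)

(* If [M] spans an edge [vw], remove [v] and put its neighbours into [M]: at least one
   of them, [w], was already there.  If removing [v] disconnects [Z], one of the two
   sides together with [v] still satisfies the bound. *)
Lemma chen_yu Z M : conn Z -> M \subset Z -> ne Z + #|M| + 2 <= 2 * #|Z| ->
  exists Q, [/\ Q != set0, Q \subset Z :\: M & stb (nb Z Q)].
Proof.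
have [n] := ubnP #|Z|; elim: n Z M => // n IH Z M ltZ cZ sMZ hle.
(* For stable [M] all of [Z :\: M] can serve as [Q]. If that were empty, [Z] would be stable and
   connected, hence at most one vertex, against the bound. *)
have [stM|] := boolP (stb M).
  exists (Z :\: M); split=> //; last first.
    apply: stbS stM; apply: nb_sub => x y _ /setDP[yZ].
    by rewrite inE yZ andbT negbK.
  apply/negP; rewrite setD_eq0 => sZM.
  have stZ : stb Z by apply: stbS stM.
  have [Z0|[v vZ]] := set_0Vmem Z; first by rewrite Z0 cards0 in hle; nlia.
  have sv : [set v] \subset Z by rewrite sub1set.
  have E : [set v] = Z.
    apply: conn_closed cZ sv _ _; first by apply/set0Pn; exists v; rewrite inE.
    by apply: nb_eq0 => x y /set1P-> /setDP[yZ _]; apply: (stbP _ stZ).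
  by move: hle (subset_leq_card sZM); rewrite -E cards1 ne1; nlia.
move=> /stbPn[v [w [vM wM vw]]].
have vZ := subsetP sMZ v vM.
have neZ := neD1 vZ; have cardZ := cardsD1 v Z; rewrite vZ in cardZ.
have [cZv|[P [sP P0 PZ nP]]] := connVcut (Z :\ v).
  (* Deleting [v] loses [#|F|] edges, while [M] loses [v] and gains at most [#|F| - 1] vertices
     because [w] is already there. The left side thus drops by at least 2, and the right side by
     exactly 2. *)
  pose F := [set y in Z :\ v | e v y].
  have cF : #|F| = dd [set v] (Z :\ v) by rewrite dd1E.
  have wF : w \in (M :\ v) :&: F.
    have wv : w != v by apply: contraTneq vw => ->; rewrite e0.
    by rewrite !inE wM vw wv (subsetP sMZ w wM).
  have cI : 0 < #|(M :\ v) :&: F| by apply/card_gt0P; exists w.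
  have cM := cardsD1 v M; rewrite vM in cM.
  have cU := cardsUI (M :\ v) F.
  have [|//||Q [Q0 sQ stQ]] := IH (Z :\ v) ((M :\ v) :|: F) _ cZv.
  - by nlia.
  - rewrite subUset setSD //=; apply/subsetP => y; rewrite inE => /andP[] //.
  - by nlia.
  exists Q; split=> //.
    by apply: subset_trans sQ _; apply/subsetP => y; rewrite !inE; clear; lia.
  (* [Q] avoids [F], so putting [v] back adds no neighbour. *)
  apply: stbS stQ; apply/subsetP => y /nbP[yZ yQ [x xQ xy]]; apply/nbP; split=> //.
    rewrite !inE yZ andbT; apply: contraTneq xy => ->.
    by have := subsetP sQ x xQ; rewrite !inE eC; clear; lia.
  by exists x.
have nP' : nb (Z :\ v) ((Z :\ v) :\: P) = set0.
  apply: nb_eq0 => x y /setDP[xZ xP] /setDP[yZ]; rewrite inE yZ andbT negbK => yP.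
  by rewrite eC; apply: (nb0P nP) => //; rewrite inE xP.
have cA := conn_cut cZ vZ sP nP.
have cB := conn_cut cZ vZ (subsetDl _ _) nP'.
set P' := (Z :\ v) :\: P in nP' cB.
have EZ : Z :\ v = P :|: P' by rewrite /P' -{1}(setID (Z :\ v) P) (setIidPr sP).
have dP : [disjoint P & P'] by apply: disjDr.
have ZP : {in P & P', forall x y, ~~ e x y}.
  by move=> x y xP yP; apply: (nb0P nP).
have vP : v \notin P by apply/negP => /(subsetP sP); rewrite !inE eqxx.
have vP' : v \notin P' by rewrite !inE eqxx /= andbF.
have P'0 : P' != set0.
  rewrite setD_eq0; apply: contra PZ => s; by rewrite eqEsubset sP.
have c1 : 0 < #|P| by rewrite card_gt0.
have c2 : 0 < #|P'| by rewrite card_gt0.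
have neA := neU1 vP; have neB := neU1 vP'.
have cardA := cardsU1 v P; have cardB := cardsU1 v P'; rewrite vP vP' in cardA cardB.
rewrite EZ neU // (dd_eq0 ZP) ddUr // in neZ.
rewrite EZ cardU // in cardZ.
have cM : #|M :&: (v |: P)| + #|M :&: (v |: P')| = #|M|.+1.
  have -> : M :&: (v |: P') = v |: (M :\: (v |: P)).
    apply/setP => y; have [->|yv] := eqVneq y v; first by rewrite !inE eqxx vM.
    rewrite !inE (negPf yv) /=; case yM: (y \in M) => /=; last by rewrite andbF.
    by have := subsetP sMZ y yM => ->; case: (y \in P).
  by rewrite cardsU1 !inE eqxx /= -(cardsID (v |: P) M) addnCA.
(* Since [v] is in [M], the set found in [v |: P1] avoids [v], so it has no neighbour in [P2]. *)
have step P1 P2 : P1 :|: P2 = Z :\ v -> {in P1 & P2, forall x y, ~~ e x y} ->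
    v \notin P1 -> 0 < #|P2| -> #|Z| = #|P1| + #|P2| + 1 ->
    conn (v |: P1) -> ne (v |: P1) + #|M :&: (v |: P1)| + 2 <= 2 * #|v |: P1| ->
    exists Q, [/\ Q != set0, Q \subset Z :\: M & stb (nb Z Q)].
  move=> EP hP v1 P20 cZ1 cP1 le1.
  have [|Q [Q0 sQ stQ]] := IH _ (M :&: (v |: P1)) _ cP1 (subsetIr _ _) le1.
    by rewrite cardsU1 v1; nlia.
  have sP1 : P1 \subset Z :\ v by rewrite -EP subsetUl.
  have inQ x : x \in Q -> x \in P1 /\ x \notin M.
    move=> /(subsetP sQ); rewrite !inE; have [->|xv] := eqVneq x v; first by rewrite vM.
    by rewrite /=; case: (x \in M) => //=; case: (x \in P1).
  exists Q; split=> //.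
    apply/subsetP => x /inQ[/(subsetP sP1)]; rewrite !inE => /andP[_ ->] ->; by [].
  apply: stbS stQ; apply/subsetP => y /nbP[yZ yQ [x xQ xy]]; apply/nbP; split=> //.
    rewrite !inE; have [//|yv] := eqVneq y v; rewrite /=.
    have : y \in P1 :|: P2 by rewrite EP !inE yv.
    by rewrite inE => /orP[//|yP2]; have [xP1 _] := inQ x xQ; have := hP x y xP1 yP2; rewrite xy.
  by exists x.
(* Over the two sides the edges sum to [ne Z], the sizes to [#|Z| + 1] and the parts of [M] to
   [#|M| + 1], as [v] counts twice. If the bound failed on both sides, it would fail for [Z] and
   [M]. *)
have [le1|le1] := leqP (ne (v |: P) + #|M :&: (v |: P)| + 2) (2 * #|v |: P|).
  by apply: (step P P') => //; nlia.
apply: (step P' P) => //; try nlia.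
- by rewrite setUC.
- by move=> x y xP yP; rewrite eC ZP.
Qed.

(* No stable cutset: a stable neighbourhood leaves nothing on the far side. *)
Definition solid V :=
  forall Q, Q \subset V -> Q != set0 -> stb (nb V Q) -> Q :|: nb V Q = V.

Definition clq C := {in C &, forall x y, x != y -> e x y}.

Lemma solid_conn V : solid V -> conn V.
Proof.
move=> sV P sP P0; apply: contraNneq => nP.
apply/eqP; move: (sV P sP P0); rewrite nP setU0; apply.
by apply/stbP => x y; rewrite inE.
Qed.

(** [M] holds every vertex of [Z] with a neighbour outside [Z]. A set [Q] given by [chen_yu] would
    have all its neighbours inside [Z], and these would form a stable cutset of [V]. *)
Lemma solid_ge V Z M : solid V -> Z \proper V -> conn Z -> M \subset Z ->
  {in Z :\: M & V :\: Z, forall x y, ~~ e x y} -> 2 * #|Z| <= ne Z + #|M| + 1.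
Proof.
move=> sV pZ cZ sM hZ; have sZ := proper_sub pZ; rewrite leqNgt; apply/negP => lt.
have [|Q [Q0 sQ stQ]] := chen_yu cZ sM; first by nlia.
have inQ x : x \in Q -> x \in Z :\: M := subsetP sQ x.
have sQZ : Q \subset Z by apply: subset_trans sQ (subsetDl _ _).
have sub : nb V Q \subset nb Z Q.
  apply/subsetP => y /nbP[yV yQ [x xQ xy]]; apply/nbP; split=> //; last by exists x.
  apply/negPn/negP => yZ; have := hZ x y (inQ x xQ); rewrite inE yV yZ xy.
  by move=> /(_ isT).
have := sV Q (subset_trans sQZ sZ) Q0 (stbS sub stQ) => E.
have : V \subset Z by rewrite -E subUset sQZ (subset_trans sub (nbS _ _)).
by move/(proper_sub_trans pZ); rewrite properxx.
Qed.

Lemma conn_addnb Y S : conn Y -> {in S, forall s, exists2 y, y \in Y & e y s} ->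
  conn (Y :|: S).
Proof.
move=> cY hS P sP P0 PZ; apply/negP => /eqP /nb0P hP; case/eqP: PZ.
have [Y0|PY0] := eqVneq (P :&: Y) set0.
  have [p pP] := set0Pn _ P0.
  have pY : p \notin Y.
    by apply/negP => pY; move: (in_set0 p); rewrite -Y0 inE pP pY.
  have /hS[y yY yp] : p \in S.
    by have := subsetP sP p pP; rewrite inE (negPf pY).
  have yP : y \notin P.
    by apply/negP => yP; move: (in_set0 y); rewrite -Y0 inE yP yY.
  by have := hP p y pP; rewrite !inE yY yP eC yp => /(_ isT).
have E : P :&: Y = Y.
  apply: conn_closed cY (subsetIr _ _) PY0 _; apply: nb_eq0 => x y.
  rewrite inE => /andP[xP _]; rewrite !inE negb_and => /andP[yP yY].
  by apply: hP => //; rewrite !inE yY; move: yP; rewrite yY orbF => ->.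
have sYP : Y \subset P by rewrite -E subsetIl.
apply/eqP; rewrite eqEsubset sP subUset sYP /=.
apply/subsetP => s sS; apply/negPn/negP => sNP; have [y yY ys] := hS s sS.
by have := hP y s (subsetP sYP y yY); rewrite !inE sNP sS orbT ys => /(_ isT).
Qed.

Lemma dd_card_nb Q Z : #|[set x in Z | [exists y in Q, e x y]]| <= dd Z Q.
Proof.
rewrite dd_sum -sum1_card big_mkcond /=.
rewrite [X in _ <= X]big_mkcond /=; apply: leq_sum => x _; rewrite inE.
case: (x \in Z) => //=; case: ifP => // /exists_inP[y yQ xy].
exact: dd_gt0 (set11 x) yQ xy.
Qed.

(** This is [solid_ge] for [Y :|: S], with [M] made of [S] and the vertices of [Y] that have a
    neighbour beyond [S]. There are at most as many of the latter as edges leaving [Y :|: S] from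
    [Y]. *)
Lemma solid_degree V Y S : solid V -> Y \subset V -> Y != set0 -> conn Y ->
  S \subset nb V Y -> stb S -> Y :|: S != V ->
  2 * #|Y| + #|S| <= ne Y + dd Y (V :\: Y) + 1.
Proof.
move=> sV sY Y0 cY sS stS YSV.
have sSV := subset_trans sS (nbS _ _).
have dYS : [disjoint Y & S] by apply: disjointWr sS (nb_disj _ _).
pose F := [set x in Y | [exists y in V :\: (Y :|: S), e x y]].
have cYS : conn (Y :|: S).
  by apply: conn_addnb => // s /(subsetP sS)/nbP[_ _ [y yY ys]]; exists y.
have pYS : Y :|: S \proper V by rewrite properEneq YSV subUset sY.
have sM : S :|: F \subset Y :|: S.
  by rewrite subUset subsetUr /=; apply/subsetP => x; rewrite !inE => /andP[->].
have := solid_ge sV pYS cYS sM _.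
have hF : {in (Y :|: S) :\: (S :|: F) & V :\: (Y :|: S), forall x y, ~~ e x y}.
  move=> x y /setDP[]; rewrite !inE => /orP[xY|->//]; rewrite xY /=.
  rewrite negb_or => /andP[_]; rewrite negb_exists_in => /forall_inP h yV.
  by apply: h; rewrite !inE.
move=> /(_ hF).
have EV : V :\: Y = S :|: (V :\: (Y :|: S)).
  apply/setP => x; rewrite !inE; case xS: (x \in S) => /=; rewrite ?orbT ?orbF //=.
  rewrite (subsetP sSV x xS) andbT; apply/negP => xY.
  by have := disjointFr dYS xY; rewrite xS.
have d1 : [disjoint S & V :\: (Y :|: S)].
  by apply: disjointP => x xS; rewrite !inE xS orbT.
have neYS : ne (Y :|: S) = ne Y + dd Y S.
  by rewrite neU //; move: stS; rewrite stb_ne => /eqP->; rewrite addn0.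
have cYSs := cardU dYS; have cF := dd_card_nb (V :\: (Y :|: S)) Y.
have := leq_card_setU S F; rewrite EV ddUr // -/F => -[cSF _].
rewrite -/F in cF; nlia.
Qed.

(** Without [c], both sides of the bound are additive over parts with no edge between them. If it
    failed on both parts, their excess would total at least [2 - 2 * c], which exceeds [- c] as
    [c <= 1]; so one part inherits the bound. *)
Lemma conn_part V O c : c <= 1 -> O \subset V -> O != set0 ->
  ne O + dd O (V :\: O) + c <= 2 * #|O| ->
  exists Y, [/\ Y \subset O, Y != set0, conn Y, nb O Y = set0
    & ne Y + dd Y (V :\: Y) + c <= 2 * #|Y|].
Proof.
move=> c1 sO O0 hO.
suff H n Y : #|Y| < n -> Y \subset O -> Y != set0 -> nb O Y = set0 ->
    ne Y + dd Y (V :\: Y) + c <= 2 * #|Y| ->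
  exists Y, [/\ Y \subset O, Y != set0, conn Y, nb O Y = set0
    & ne Y + dd Y (V :\: Y) + c <= 2 * #|Y|].
  apply: (H _ O (ltnSn _)) => //.
  by apply: nb_eq0 => x y _; rewrite setDv inE.
elim: n Y => // n IH Y ltY sY Y0 nY hY.
have [cY|[P [sP P0 PY nP]]] := connVcut Y; first by exists Y.
have P'0 : Y :\: P != set0.
  by rewrite setD_eq0; apply: contra PY => s; rewrite eqEsubset sP.
have zP : {in P & Y :\: P, forall x y, ~~ e x y} by move=> x y xP yP; apply: (nb0P nP).
have EY : Y = P :|: (Y :\: P) by rewrite -{1}(setID Y P) (setIidPr sP).
have dP := disjDr P Y.
have sYV := subset_trans sY sO.
have cl R R' : R \subset Y -> R' = Y :\: R -> {in R & R', forall x y, ~~ e x y} ->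
    nb O R = set0 /\ dd R (V :\: R) = dd R (V :\: Y).
  move=> sR -> zR; split.
    apply: nb_eq0 => x y xR /setDP[yO yR].
    have [yY|yY] := boolP (y \in Y); first by apply: zR; rewrite // inE yR.
    by apply: (nb0P nY); rewrite ?(subsetP sR) // inE yY.
  have -> : V :\: R = (V :\: Y) :|: (Y :\: R).
    apply/setP => x; rewrite !inE; case xY: (x \in Y) => /=.
      by rewrite (subsetP sYV x xY) ?andbT ?orbF.
    rewrite andbF orbF; case xR: (x \in R) => //.
    by have := subsetP sR x xR; rewrite xY.
  rewrite ddUr ?(dd_eq0 zR) ?addn0 //.
  by apply: disjointP => x; rewrite !inE => /andP[/negPf->]; rewrite andbF.
have EYP : P = Y :\: (Y :\: P) by rewrite setDDr setDv set0U (setIidPr sP).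
have [n1 d1] := cl P _ sP erefl zP.
have [|n2 d2] := cl (Y :\: P) P (subsetDl _ _) EYP.
  by move=> x y xP yP; rewrite eC zP.
have neY := neU dP; have cY := cardU dP; rewrite -EY (dd_eq0 zP) in neY; rewrite -EY in cY.
have dY : dd Y (V :\: Y) = dd P (V :\: Y) + dd (Y :\: P) (V :\: Y).
  by rewrite {1}EY ddUl.
have p1 : 0 < #|P| by rewrite card_gt0.
have p2 : 0 < #|Y :\: P| by rewrite card_gt0.
have [le|gt] := leqP (ne P + dd P (V :\: P) + c) (2 * #|P|).
  by apply: IH le => //; [nlia|exact: subset_trans sP sY].
apply: (IH (Y :\: P)) => //; first by nlia.
  exact: subset_trans (subsetDl _ _) sY.
by rewrite d2; rewrite d1 in gt; nlia.
Qed.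

Lemma ne_split V U : U \subset V ->
  ne V = ne U + (ne (V :\: U) + dd (V :\: U) (V :\: (V :\: U))).
Proof.
move=> sU; rewrite setDDr setDv set0U (setIidPr sU) -{1}(setID V U) (setIidPr sU).
by rewrite neU ?disjDr // (ddC U); lia.
Qed.

(** If [U] had too many edges, few would touch [V :\: U], and some component [Y] of it would satisfy
    the bound of [conn_part] with [c = 1]. This contradicts [solid_degree] with [S] a single
    neighbour of [Y]. *)
Lemma sparse V U : solid V -> ne V + 3 <= 2 * #|V| -> U \subset V -> 2 <= #|U| ->
  ne U + 3 <= 2 * #|U|.
Proof.
move=> sV hV sU U2; have [->//|UV] := eqVneq U V.
rewrite leqNgt; apply/negP => lt.
have O0 : V :\: U != set0.
  by rewrite setD_eq0; apply: contra UV => s; rewrite eqEsubset sU.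
have cO : #|V| = #|U| + #|V :\: U| by rewrite -(cardsID U V) (setIidPr sU).
have neV := ne_split sU.
have [|Y [sY Y0 cY nY hY]] := @conn_part V (V :\: U) 1 isT (subsetDl _ _) O0.
  by nlia.
have sYV := subset_trans sY (subsetDl _ _).
have YnV : Y != V.
  have /card_gt0P[u uU] : 0 < #|U| by nlia.
  apply/eqP => E; have := subsetP sY u; rewrite E (subsetP sU u uU) !inE uU.
  by move=> /(_ isT).
have [s sN] := set0Pn _ (solid_conn sV sYV Y0 YnV).
have s1 : [set s] \subset nb V Y by rewrite sub1set.
have st1 : stb [set s] by apply/stbP => x y /set1P-> /set1P->; rewrite e0.
have hN : Y :|: [set s] != V.
  apply/eqP => E; have : U \subset [set s].
    apply/subsetP => u uU; have := subsetP sU u uU; rewrite -E => /setUP[uY|//].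
    by have := subsetP sY u uY; rewrite in_setD uU.
  by move/subset_leq_card; rewrite cards1 => ?; nlia.
have := solid_degree sV sYV Y0 cY s1 st1 hN; rewrite cards1 => ?; nlia.
Qed.

Lemma clq_ne C : clq C -> 2 * ne C = #|C| * #|C|.-1.
Proof.
move=> cC; have := dd_even C; rewrite dd_sum (eq_bigr (fun=> #|C|.-1)).
  by rewrite sum_nat_const; lia.
move=> x xC; rewrite dd1E (cardsD1 x C) xC /=; apply: eq_card => y; rewrite !inE.
have [->|yx] := eqVneq y x; first by rewrite e0 andbF.
by case yC: (y \in C) => //=; apply/idP; apply: cC; rewrite // eq_sym.
Qed.

Lemma clq_small V C : solid V -> ne V + 3 <= 2 * #|V| -> C \subset V -> clq C ->
  #|C| <= 3.
Proof.
move=> sV hV sC cC; rewrite leqNgt; apply/negP => C4.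
have := sparse sV hV sC (leq_trans (isT : 2 <= 4) C4); have := clq_ne cC.
by move: #|C| (ne C) C4 => k m; clear; nia.
Qed.

(** The analogue of [solid] for cliques: there is no separating clique. *)
Definition unsplit V := forall Y, Y \subset V -> Y != set0 ->
  clq (nb V Y) -> Y :|: nb V Y = V.

(** As for [sparse], now with [c = 0]. Two nonadjacent neighbours of [Y] would contradict
    [solid_degree], so [nb V Y] is a clique. It has at most three vertices and cannot cover [U],
    which makes it a separating clique. *)
Lemma sparser V U : solid V -> ne V + 3 <= 2 * #|V| -> unsplit V ->
  U \proper V -> 4 <= #|U| -> ne U + 4 <= 2 * #|U|.
Proof.
move=> sV hV uV pU U4; have sU := proper_sub pU.
rewrite leqNgt; apply/negP => lt.
have O0 : V :\: U != set0.
  rewrite setD_eq0; apply/negP => s; move: pU; rewrite properE s andbF //.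
have cO : #|V| = #|U| + #|V :\: U| by rewrite -(cardsID U V) (setIidPr sU).
have neV := ne_split sU.
have [|Y [sY Y0 cY nY hY]] := @conn_part V (V :\: U) 0 isT (subsetDl _ _) O0.
  by nlia.
have sYV := subset_trans sY (subsetDl _ _).
have hN S : #|S| <= 3 -> Y :|: S != V.
  move=> S3; apply/eqP => E; have : U \subset S.
    apply/subsetP => u uU; have := subsetP sU u uU; rewrite -E => /setUP[uY|//].
    by have := subsetP sY u uY; rewrite in_setD uU.
  by move/subset_leq_card => ?; nlia.
have cN : clq (nb V Y).
  move=> a b aN bN ab; apply/negPn/negP => nab.
  have sS : [set a; b] \subset nb V Y by apply/subsetP => x /set2P[]->.
  have stS : stb [set a; b].
    by apply/stbP => x y /set2P[]-> /set2P[]->; rewrite ?e0 // eC.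
  have cS : #|[set a; b]| = 2 by rewrite cards2 ab.
  have := solid_degree sV sYV Y0 cY sS stS; rewrite cS hN ?cS // => /(_ isT) ?.
  by nlia.
have := hN (nb V Y) (clq_small sV hV (nbS _ _) cN).
by rewrite uV ?eqxx.
Qed.

(* While [nb W P] spans an edge [bc], one of [b], [c] can be added to [P]: otherwise two
   sets on which the hypothesis is tight, one containing [b] and one containing [c],
   have a union that violates it because of the edge [bc].  For a single vertex [B]
   take [k = 2], for an edge [k = 3]. *)
Lemma separation W P B k : P \subset W -> B \subset W :\: P -> 2 * #|B| <= ne B + k ->
    (forall X, B \subset X -> X \subset W :\: P ->
      ne X + #|X :&: nb W P| + k <= 2 * #|X|) ->
  exists Q, [/\ P \subset Q, Q \subset W, stb (nb W Q)
    & [disjoint B & Q :|: nb W Q]].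
Proof.
have [n] := ubnP #|W :\: P|; elim: n P => // n IH P ltP sP sB hB H.
(* The hypothesis at [X = B] meets the lower bound on [ne B], which leaves no room for a neighbour
   of [P] in [B]. *)
have BN : B :&: nb W P = set0.
  by apply/eqP; rewrite -cards_eq0; have := H B (subxx _) sB; nlia.
have inB x : x \in B -> (x \in W) && (x \notin P).
  by move=> /(subsetP sB); rewrite inE andbC.
have [stN|] := boolP (stb (nb W P)).
  exists P; split=> //; apply: disjointP => x xB; rewrite inE => /orP[xP|xN].
    by have := inB x xB; rewrite xP andbF.
  by move: (in_set0 x); rewrite -BN inE xB xN.
move=> /stbPn[b [c [bN cN bc]]].
(* The hypothesis on [P] survives the addition of [a]. *)
pose ok a := [forall X : {set T}, (B \subset X) && (X \subset W :\: (a |: P)) ==>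
  (ne X + #|X :&: nb W (a |: P)| + k <= 2 * #|X|)].
have grow a : a \in nb W P -> ok a -> exists Q, [/\ P \subset Q, Q \subset W, stb (nb W Q)
    & [disjoint B & Q :|: nb W Q]].
  move=> aN /forallP oka; have [aW aP _] := nbP _ _ _ aN.
  have [|||//|X sBX sX|Q [sQ ? ? ?]] := IH (a |: P).
  - have : W :\: (a |: P) \proper W :\: P.
      rewrite properE; apply/andP; split; first by rewrite setDS // subsetUr.
      by apply/subsetPn; exists a; rewrite !inE ?aP // eqxx.
    by move/proper_card; nlia.
  - by rewrite subUset sub1set aW.
  - apply/subsetP => x xB; have /andP[xW xP] := inB x xB; rewrite !inE xW (negPf xP) orbF andbT.
    by apply/eqP => xa; move: (in_set0 x); rewrite -BN inE xB xa aN.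
  - by have := oka X; rewrite sBX sX.
  - by exists Q; split=> //; apply: subset_trans sQ; apply: subsetUr.
(* If the hypothesis for [a |: P] fails at [X], comparing it with the one for [P] at [a |: X] shows
   that [a |: X] is tight and that no neighbour of [a] in [X] is already in [nb W P]. Hence [a'] is
   not in [X]. *)
have bad a a' : a \in nb W P -> a' \in nb W P -> e a a' -> ~~ ok a ->
  exists A, [/\ B \subset A, A \subset W :\: P, a \in A, a' \notin A
    & 2 * #|A| <= ne A + #|A :&: nb W P| + k].
  move=> aN a'N aa' /forallPn[X]; rewrite negb_imply -ltnNge => /andP[/andP[sBX sX] lt].
  have [aW aP _] := nbP _ _ _ aN; have [a'W a'P _] := nbP _ _ _ a'N.
  have aX : a \notin X by apply/negP => /(subsetP sX); rewrite !inE eqxx.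
  have sXP : X \subset W :\: P by apply: subset_trans sX _; rewrite setDS // subsetUr.
  have sA : a |: X \subset W :\: P by rewrite subUset sub1set inE aW aP.
  have sBA : B \subset a |: X by apply: subset_trans sBX (subsetUr _ _).
  have cA : #|a |: X| = #|X|.+1 by rewrite cardsU1 aX.
  have nA := neU1 aX.
  have iA : #|(a |: X) :&: nb W P| = #|X :&: nb W P|.+1.
    rewrite setIUl cardU; last first.
      by apply: disjointP => x; rewrite !inE => /andP[/eqP-> _]; rewrite (negPf aX).
    by rewrite (setIidPl _) ?sub1set // cards1 add1n.
  have HA := H _ sBA sA.
  pose F := [set y in X | e a y].
  have cF : #|F| = dd [set a] X by rewrite dd1E.
  have sub : X :&: nb W (a |: P) \subset (X :&: nb W P) :|: F.
    apply/subsetP => y; rewrite in_setI => /andP[yX /nbP[yW yP [x xP xy]]].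
    move: xP; rewrite in_setU1 => /predU1P[xa|xP].
      by apply/setUP; right; rewrite inE yX -xa.
    apply/setUP; left; rewrite in_setI yX; apply/nbP; split=> //; last by exists x.
    by apply: contra yP => yP; rewrite inE yP orbT.
  have := subset_leq_card sub; have := cardsUI (X :&: nb W P) F.
  have [a'X|a'X] := boolP (a' \in X).
    have : 0 < #|(X :&: nb W P) :&: F|.
      by apply/card_gt0P; exists a'; rewrite !in_setI a'X a'N inE a'X aa'.
    by move=> *; exfalso; nlia.
  move=> h1 h2; exists (a |: X); split=> //; first exact: setU11.
    rewrite !inE negb_or a'X andbT; apply/eqP => E; by rewrite E e0 in aa'.
  by nlia.
have [okb|nokb] := boolP (ok b); first exact: grow okb.
have [okc|nokc] := boolP (ok c); first exact: grow okc.
have [A [sBA sA bA cA hA]] := bad b c bN cN bc nokb.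
have cb : e c b by rewrite eC.
have [C [sBC sC cC bC hC]] := bad c b cN bN cb nokc.
have := H (A :|: C) (subset_trans sBA (subsetUl _ _)).
rewrite subUset sA sC => /(_ isT).
have sAC : A :&: C \subset W :\: P by apply: subset_trans sA; apply: subsetIl.
have := H (A :&: C); rewrite subsetI sBA sBC => /(_ isT sAC).
have := ne_supermod A C; have := cardsUI A C.
have := cardsUI (A :&: nb W P) (C :&: nb W P).
rewrite -setIUl setIACA setIid.
have bAC : b \in A :\: C by rewrite inE bA bC.
have cCA : c \in C :\: A by rewrite inE cC cA.
have := dd_gt0 bAC cCA bc.
by move=> *; exfalso; nlia.
Qed.

Lemma solid_cut V Q v : solid V -> Q \subset V -> Q != set0 -> stb (nb V Q) ->
  v \in V -> v \notin Q -> v \notin nb V Q -> False.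
Proof.
move=> sV sQ Q0 stQ vV vQ vN; move: vV; rewrite -(sV Q sQ Q0 stQ) inE.
by rewrite (negPf vQ) (negPf vN).
Qed.

Lemma dd1_le v X : dd [set v] X <= #|X|.
Proof. by rewrite dd1E; apply/subset_leq_card/subsetP => y; rewrite inE => /andP[]. Qed.

Lemma ddU1 v x X : x \notin X -> dd [set v] (x |: X) = e v x + dd [set v] X.
Proof. by move=> xX; rewrite ddUr ?disjoints1 // dd11. Qed.

Lemma ne_small X : #|X| <= 1 -> ne X = 0.
Proof.
have [->|[x xX]] := set_0Vmem X; first by rewrite ne0.
move=> X1; rewrite (neD1 xX); have := cardsD1 x X; rewrite xX => c.
have /eqP : #|X :\ x| = 0 by nlia.
by rewrite cards_eq0 => /eqP->; rewrite ne0 dd0r.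
Qed.

(** * Sparse solid graphs without separating cliques *)

Section Unsplit.
Variable V : {set T}.
Hypotheses (sV : solid V) (hV : ne V + 3 <= 2 * #|V|) (usV : unsplit V) (V4 : 4 <= #|V|).

(** With the pair [u], [v] missing, the bound of [sparser] also holds on two vertices (no edge) and
    on three (at most two edges). *)
Lemma sparse_nonadjacent U u v : U \proper V -> u \in U -> v \in U -> u != v ->
  ~~ e u v -> ne U + 4 <= 2 * #|U|.
Proof.
move=> pU uU vU uv nuv; have [U4|U3] := leqP 4 #|U|; first exact: (sparser sV hV usV).
have vU' : v \in U :\ u by rewrite !inE eq_sym uv.
have neu := neD1 uU; have nev := neD1 vU'.
have cu := cardsD1 u U; rewrite uU in cu; have cv := cardsD1 v (U :\ u); rewrite vU' in cv.
have := dd1_le v (U :\ u :\ v); have := dd1_le u (U :\ u :\ v).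
have : dd [set u] (U :\ u) = dd [set u] (U :\ u :\ v).
  by rewrite -{1}(setD1K vU') ddU1 ?(negPf nuv) // !inE eqxx.
have : ne (U :\ u :\ v) = 0 by apply: ne_small; nlia.
by nlia.
Qed.

(** In [separation] with [P = [set u]], the neighbours of [u] in [X] count the edges from [u] to
    [X], so its hypothesis is the sparseness of [u |: X]. *)
Lemma separate W u v : W \proper V -> u \in W -> v \in W -> u != v -> ~~ e u v ->
  exists Q, [/\ u \in Q, Q \subset W, stb (nb W Q), v \notin Q & v \notin nb W Q].
Proof.
move=> pW uW vW uv nuv.
have [|||X sX sXW|Q [uQ sQ stQ vQ]] := @separation W [set u] [set v] 2.
- by rewrite sub1set.
- by rewrite sub1set !inE eq_sym uv.
- by rewrite cards1 ne1.
- rewrite sub1set in sX.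
  have uX : u \notin X by apply/negP => /(subsetP sXW); rewrite !inE eqxx.
  have -> : #|X :&: nb W [set u]| = dd [set u] X.
    rewrite dd1E; apply: eq_card => y; rewrite in_setI [RHS]inE.
    have [yX|//] := boolP (y \in X); rewrite /=.
    apply/nbP/idP => [[_ _ [x /set1P->]]//|uy]; split; last by exists u; rewrite ?set11.
      by have := subsetP sXW y yX; rewrite in_setD => /andP[].
    by have := subsetP sXW y yX; rewrite in_setD => /andP[].
  have pU : u |: X \proper V.
    apply: sub_proper_trans pW; rewrite subUset sub1set uW.
    exact: subset_trans sXW (subsetDl _ _).
  have := sparse_nonadjacent pU (setU11 _ _) (setU1r _ sX) uv nuv.
  by rewrite neU1 // cardsU1 uX; nlia.
rewrite sub1set in uQ; exists Q; split=> //.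
  by move: vQ; rewrite disjoints1 inE negb_or => /andP[].
by move: vQ; rewrite disjoints1 inE negb_or => /andP[].
Qed.

(** Two triangles on the edge [cd] would span five edges on four vertices, too many for a proper
    subset. If the four vertices were all of [V], an edge [ab] would make six edges, and otherwise
    the clique [cd] would separate [a] from [b]. *)
Lemma one_triangle a b c d : a \in V -> b \in V -> c \in V -> d \in V ->
  e c d -> e a c -> e a d -> e b c -> e b d -> a = b.
Proof.
move=> aV bV cV dV cd ac ad bc bd; apply/eqP/negPn/negP => ab.
have neq x y : e x y -> x != y by move=> xy; apply: contraTneq xy => ->; rewrite e0.
have ncd := neq _ _ cd; have nac := neq _ _ ac; have nad := neq _ _ ad.
have nbc := neq _ _ bc; have nbd := neq _ _ bd.
pose U := a |: (b |: (c |: [set d])).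
have cU : #|U| = 4.
  by rewrite !cardsU1 cards1 !inE !negb_or ab nac nad nbc nbd ncd.
have neUab : ne U = e a b + 5.
  rewrite !neU1 ?ddU1 ?dd11 ?ne1 ?inE ?negb_or ?ab ?nac ?nad ?nbc ?nbd ?ncd //.
  by rewrite ac ad bc bd cd; clear; lia.
have sU : U \subset V by rewrite !subUset !sub1set aV bV cV dV.
have [UV|nUV] := eqVneq U V; last first.
  have pU : U \proper V by rewrite properEneq nUV.
  by have := sparser sV hV usV pU; rewrite cU neUab => /(_ isT) h; nlia.
have [eab|neab] := boolP (e a b).
  by move: hV; rewrite -UV neUab cU eab.
have nb_a : nb V [set a] \subset [set c; d].
  apply/subsetP => y /nbP[]; rewrite -UV => yU _ [x /set1P-> ay]; move: yU ay.
  rewrite !inE => /or4P[] /eqP->; rewrite ?eqxx ?orbT // ?e0 //.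
  by rewrite (negPf neab).
have a1 : [set a] \subset V by rewrite sub1set.
have a0 : [set a] != set0 by apply/set0Pn; exists a; rewrite inE.
have clN : clq (nb V [set a]).
  move=> x y /(subsetP nb_a)/set2P[]-> /(subsetP nb_a)/set2P[]->; rewrite ?eqxx //.
  by rewrite eC.
have E := usV a1 a0 clN.
move: bV; rewrite -E !in_setU in_set1 eq_sym (negPf ab) /=.
by move/(subsetP nb_a); rewrite !inE (negPf nbc) (negPf nbd).
Qed.

(** At most two neighbours are either stable or a clique, and both are excluded since a fourth
    vertex remains. *)
Lemma degree_ge3 v : v \in V -> 3 <= dd [set v] V.
Proof.
move=> vV; rewrite leqNgt; apply/negP => lt.
have v1 : [set v] \subset V by rewrite sub1set.
have v0 : [set v] != set0 by apply/set0Pn; exists v; rewrite inE.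
have cN : #|nb V [set v]| <= 2.
  rewrite -ltnS; apply: leq_ltn_trans lt; rewrite dd1E.
  by apply/subset_leq_card/subsetP => y /nbP[yV _ [x /set1P->]]; rewrite inE yV.
have big : [set v] :|: nb V [set v] != V.
  apply/eqP => E; move: V4; rewrite -E cardU ?nb_disj // cards1; nlia.
case/eqP: big; have [st|] := boolP (stb (nb V [set v])); first exact: sV.
move=> /stbPn[a [b [aN bN ab]]]; apply: usV => //.
have nab : a != b by apply: contraTneq ab => ->; rewrite e0.
have E : [set a; b] = nb V [set v].
  apply/eqP; rewrite eqEcard cards2 nab cN andbT.
  by apply/subsetP => x /set2P[]->.
rewrite -E => x y /set2P[]-> /set2P[]->; rewrite ?eqxx // => _; by rewrite eC.
Qed.

(** * Adjacent vertices of degree three *)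

(** Two disjoint triangles [xyz] and [wpq] joined by an edge [xw] whose ends have degree three in
    [V]. *)
Definition gadget x y z w p q :=
  [/\ uniq [:: x; y; z; w; p; q], {subset [:: x; y; z; w; p; q] <= V},
      {in V, forall u, e x u = (u \in [:: y; z; w])},
      {in V, forall u, e w u = (u \in [:: x; p; q])} & e y z && e p q].

Lemma edge_neq x y : e x y -> x != y.
Proof. by apply: contraTneq => ->; rewrite e0. Qed.

Lemma nb1E v u : (u \in nb V [set v]) = (u \in V) && e v u.
Proof.
apply/nbP/andP => [[uV _ [x /set1P->]]//|[uV vu]]; split=> //.
  by rewrite inE eq_sym edge_neq.
by exists v; rewrite ?set11.
Qed.

Lemma card_nb1 v : #|nb V [set v]| = dd [set v] V.
Proof. by rewrite dd1E; apply: eq_card => u; rewrite nb1E inE. Qed.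

Lemma gadget_exists : exists x y z w p q, gadget x y z w p q.
Proof.
(* The degree sum is at most [4 * #|V| - 6], so some vertex has degree three. *)
have sumd : \sum_(v in V) dd [set v] V + 6 <= 4 * #|V|.
  by rewrite -dd_sum dd_even; nlia.
have V5 : 5 <= #|V|.
  have : \sum_(v in V) 3 <= \sum_(v in V) dd [set v] V.
    by apply: leq_sum => v; apply: degree_ge3.
  by rewrite sum_nat_const => ?; nlia.
have [x xV dx] : exists2 x, x \in V & dd [set x] V <= 3.
  apply/exists_inP; rewrite -[X in is_true X]negbK negb_exists_in.
  apply/negP => /forall_inP h.
  have : \sum_(v in V) 4 <= \sum_(v in V) dd [set v] V.
    by apply: leq_sum => v /h; rewrite -ltnNge.
  by rewrite sum_nat_const => ?; nlia.
have cN : #|nb V [set x]| = 3.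
  by apply/eqP; rewrite card_nb1 eqn_leq dx degree_ge3.
have x1 : [set x] \subset V by rewrite sub1set.
have x0 : [set x] != set0 by apply/set0Pn; exists x; rewrite inE.
have : ~~ stb (nb V [set x]).
  apply/negP => st; have := sV x1 x0 st => E; move: V5.
  by rewrite -E cardU ?nb_disj // cards1 cN.
move=> /stbPn[y [z [yN zN yz]]].
have [w wE] : exists w, nb V [set x] :\ y :\ z = [set w].
  have nyz := edge_neq yz.
  apply/cards1P; have := cardsD1 y (nb V [set x]); have := cardsD1 z (nb V [set x] :\ y).
  by rewrite yN in_setD1 eq_sym nyz zN cN /= => c1 c2; apply/eqP; nlia.
have : w \in nb V [set x] :\ y :\ z by rewrite wE set11.
rewrite !in_setD1 => /and3P[wz wy wN].
move: yN zN wN; rewrite !nb1E => /andP[yV xy] /andP[zV xz] /andP[wV xw].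
have [yx zx wx] : [/\ e y x, e z x & e w x] by rewrite !(eC _ x).
have zy : e z y by rewrite eC.
have nwy : ~~ e w y.
  apply/negP => nwy; case/eqP: wz.
  exact: (one_triangle wV zV xV yV).
have nwz : ~~ e w z.
  apply/negP => nwz; case/eqP: wy.
  exact: (one_triangle wV yV xV zV).
have Nx : {in V, forall u, e x u = (u \in [:: y; z; w])}.
  move=> u uV; rewrite !inE; apply/idP/idP => [xu|/or3P[]/eqP->//].
  have [->//|uy] := eqVneq u y; have [->|uz] := eqVneq u z; first by rewrite orbT.
  by rewrite /= -(in_set1 u w) -wE !in_setD1 uz uy nb1E uV.
(* Otherwise [separate] in [V :\ x] gives [Q] containing [u], with the common neighbour [w] in its
   stable neighbourhood. If [Q] meets [{y, z}], adding [x] to it creates no new neighbour; if not,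
   [x] is not adjacent to [Q]. Both ways [V] has a stable cutset. *)
have Ncl u v : u \in V -> v \in V -> u != x -> v != x -> e w u -> e w v -> u != v -> e u v.
  move=> uV vV ux vx wu wv uv; apply/negPn/negP => nuv.
  have uW : u \in V :\ x by rewrite !inE ux.
  have vW : v \in V :\ x by rewrite !inE vx.
  have pW : V :\ x \proper V by rewrite properD1.
  have [Q [uQ sQ stQ vQ vN]] := separate pW uW vW uv nuv.
  set N := nb (V :\ x) Q in stQ vN.
  have sQV : Q \subset V by apply: subset_trans sQ (subsetDl _ _).
  have closed a b : a \in Q -> b \in V -> b != x -> e a b -> b \in Q \/ b \in N.
    move=> aQ bV bx ab; have [bQ|bQ] := boolP (b \in Q); [by left|right].
    by apply/nbP; rewrite !inE bx bV; split=> //; exists a.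
  have wQ : w \notin Q.
    apply/negP => wQ; have [|] := closed w v wQ vV vx wv; first by rewrite (negPf vQ).
    by rewrite (negPf vN).
  have wNQ : w \in N.
    have uw : e u w by rewrite eC.
    by have [|//] := closed u w uQ wV (edge_neq wx) uw; rewrite (negPf wQ).
  have [yzQ|yzQ] := boolP ((y \in Q) || (z \in Q)).
    have subN : nb V (x |: Q) \subset N.
      apply/subsetP => b /nbP[bV]; rewrite in_setU1 negb_or => /andP[bx bQ] [a].
      rewrite in_setU1 => /predU1P[->|aQ] ab.
        have : [|| b == y, b == z | b == w] by have := Nx b bV; rewrite ab !inE => <-.
        move: bQ => + /or3P[]/eqP E; rewrite {b bV bx ab}E // => bQ.
          move: yzQ; rewrite (negPf bQ) /= => zQ.
          by have [|//] := closed z y zQ yV (edge_neq yx) zy; rewrite (negPf bQ).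
        move: yzQ; rewrite (negPf bQ) orbF => yQ.
        by have [|//] := closed y z yQ zV (edge_neq zx) yz; rewrite (negPf bQ).
      by have [|//] := closed a b aQ bV bx ab; rewrite (negPf bQ).
    apply: (@solid_cut V (x |: Q) v sV); rewrite ?subUset ?x1 //.
    - by apply/set0Pn; exists x; rewrite setU11.
    - exact: stbS subN stQ.
    - by rewrite !inE negb_or vx.
    - by apply: contra vN; apply: (subsetP subN).
  have subN : nb V Q \subset N.
    apply/subsetP => b /nbP[bV bQ [a aQ ab]].
    have bx : b != x.
      apply: contraNneq yzQ => bx; move: ab; rewrite bx eC Nx ?(subsetP sQV) // !inE.
      by move=> /or3P[]/eqP E; move: aQ; rewrite E ?(negPf wQ) // => ->; rewrite ?orbT.
    by have [|//] := closed a b aQ bV bx ab; rewrite (negPf bQ).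
  apply: (@solid_cut V Q v sV) => //.
  - by apply/set0Pn; exists u.
  - exact: stbS subN stQ.
  - by apply: contra vN; apply: (subsetP subN).
have : 1 < #|nb V [set w] :\ x|.
  have := cardsD1 x (nb V [set w]); rewrite nb1E xV wx card_nb1.
  by have := degree_ge3 wV => *; nlia.
move=> /card_gt1P[p [q [pN qN npq]]].
move: pN qN; rewrite !in_setD1 !nb1E => /and3P[px pV wp] /and3P[qx qV wq].
have pq : e p q by apply: Ncl.
have qp : e q p by rewrite eC.
(* The neighbours of [w] other than [x] form a clique, so a third one would give the edge [wp] a
   second triangle. *)
have Nw : {in V, forall u, e w u = (u \in [:: x; p; q])}.
  move=> u uV; rewrite !inE; apply/idP/idP => [wu|/or3P[]/eqP->//].
  have [->//|ux] := eqVneq u x; have [->//|up] := eqVneq u p; rewrite /=; apply/eqP.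
  have [uw qw] : e u w /\ e q w by rewrite !(eC _ w).
  apply: (one_triangle uV qV wV pV wp uw _ qw qp).
  by apply: Ncl.
exists x, y, z, w, p, q; split=> //; last by rewrite yz.
- have wpq a b : e w a -> ~~ e w b -> b != a by move=> wa; apply: contraNneq => ->.
  have [xp xq] : x != p /\ x != q by rewrite ![x == _]eq_sym px qx.
  have [yw zw] : y != w /\ z != w by rewrite ![_ == w]eq_sym wy wz.
  rewrite /= !inE !negb_or (edge_neq xy) (edge_neq xz) (edge_neq xw) xp xq.
  rewrite (edge_neq yz) yw zw (edge_neq wp) (edge_neq wq) npq.
  by rewrite !(wpq _ _ wp) ?(wpq _ _ wq).
- by move=> u; rewrite !inE => /or4P[/eqP->|/eqP->|/eqP->|/or3P[]/eqP->].
Qed.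

Lemma gadget_swapl x y z w p q : gadget x y z w p q -> gadget x z y w p q.
Proof.
case=> [un sub Nx Nw /andP[yz pq]]; split=> //; last by rewrite eC yz.
- by rewrite -(perm_uniq (_ : perm_eq [:: x; y; z; w; p; q] _)) //;
    apply/permP => a /=; clear; lia.
- by move=> u; rewrite !inE => h; apply: sub; rewrite !inE; move: h; clear; lia.
- by move=> u uV; rewrite Nx // !inE; clear; lia.
Qed.

Lemma gadget_swapr x y z w p q : gadget x y z w p q -> gadget x y z w q p.
Proof.
case=> [un sub Nx Nw /andP[yz pq]]; split=> //; last by rewrite yz eC.
- by rewrite -(perm_uniq (_ : perm_eq [:: x; y; z; w; p; q] _)) //;
    apply/permP => a /=; clear; lia.
- by move=> u; rewrite !inE => h; apply: sub; rewrite !inE; move: h; clear; lia.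
- by move=> u uV; rewrite Nw // !inE; clear; lia.
Qed.

Lemma gadget_flip x y z w p q : gadget x y z w p q -> gadget w p q x y z.
Proof.
case=> [un sub Nx Nw /andP[yz pq]]; split=> //; last by rewrite pq.
- by rewrite -(perm_uniq (_ : perm_eq [:: x; y; z; w; p; q] _)) //;
    apply/permP => a /=; clear; lia.
- by move=> u; rewrite !inE => h; apply: sub; rewrite !inE; move: h; clear; lia.
- by move=> u uV; rewrite Nw // !inE; clear; lia.
- by move=> u uV; rewrite Nx // !inE; clear; lia.
Qed.

Lemma gadgetE x y z w p q : gadget x y z w p q ->
  [/\ x \in V, y \in V, z \in V, w \in V & p \in V /\ q \in V] /\
  [/\ e x y, e x z, e x w, e w p & e w q] /\
  [/\ e y z, e p q, x != y, x != z & x != w] /\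
  [/\ w != p, w != q, x != p, x != q & p != q] /\
  [/\ y != z, y != w, z != w & [/\ y != p, y != q, z != p & z != q]].
Proof.
case=> [un sub Nx Nw /andP[yz pq]].
have [xV yV zV wV] : [/\ x \in V, y \in V, z \in V & w \in V].
  by split; apply: sub; rewrite !inE eqxx ?orbT.
have [pV qV] : p \in V /\ q \in V by split; apply: sub; rewrite !inE eqxx ?orbT.
move: un; rewrite /= !inE !negb_or !andbT.
move=> /and5P[/and5P[? ? ? ? ?] /and4P[? ? ? ?] /and3P[? ? ?] /andP[? ?] ?].
by rewrite !Nx // !Nw // !inE !eqxx ?orbT.
Qed.

(** Outside itself [C] is adjacent only to [A]. Hence a closed part of [U :\: C] that misses [A] is
    closed in [U] and so empty; one that meets [A] contains it, and its complement misses [A]. *)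
Lemma conn_compl U A C : conn U -> conn A -> A \subset U -> C \subset U :\: A ->
  nb (U :\: A) C = set0 -> C != set0 -> A != set0 -> conn (U :\: C).
Proof.
move=> cU cA sA sC /nb0P nC C0 A0.
have dAC x : x \in A -> x \notin C.
  by move=> xA; apply/negP => /(subsetP sC); rewrite inE xA.
have sAC : A \subset U :\: C.
  by apply/subsetP => x xA; rewrite inE dAC // (subsetP sA).
have noA P : P \subset U :\: C -> nb (U :\: C) P = set0 -> {in P, forall x, x \notin A} ->
    P = set0.
  move=> sP /nb0P nP PA; apply/eqP/negPn/negP => P0.
  have sPU := subset_trans sP (subsetDl _ _).
  have E : P = U.
    apply: (conn_closed cU sPU P0); apply: nb_eq0 => a b aP /setDP[bU bP].
    have [bC|bC] := boolP (b \in C); last by apply: nP; rewrite // !inE bP bC.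
    rewrite eC; apply: nC => //; rewrite !inE PA // (subsetP sPU a aP) !andbT.
    by have := subsetP sP a aP; rewrite inE => /andP[].
  have [a aA] := set0Pn _ A0; have := PA a; rewrite E (subsetP sA a aA) aA.
  by move=> /(_ isT).
move=> P sP P0 PU; apply/negP => /eqP nP; have hP := nb0P nP.
have [AP0|AP] := eqVneq (A :&: P) set0.
  have E := noA P sP nP; case/eqP: P0; apply: E => x xP.
  by apply/negP => xA; move: (in_set0 x); rewrite -AP0 inE xA xP.
have E : A :&: P = A.
  apply: (conn_closed cA (subsetIl _ _) AP); apply: nb_eq0 => a b.
  rewrite in_setI => /andP[aA aP] /setDP[bA]; rewrite in_setI bA /= => bP.
  by apply: hP; rewrite // in_setD bP (subsetP sAC).
have sAP : A \subset P by rewrite -E subsetIr.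
have := noA ((U :\: C) :\: P) (subsetDl _ _) => E'.
case/eqP: PU; apply/eqP; rewrite eqEsubset sP -setD_eq0; apply/eqP/E'.
  apply: nb_eq0 => a b /setDP[aU aP] /setDP[bU]; rewrite in_setD bU andbT negbK => bP.
  by rewrite eC; apply: hP => //; rewrite in_setD aP.
by move=> a /setDP[_]; apply: contra; apply: (subsetP sAP).
Qed.

(* The neighbours of [Q] may be adjacent to [z], so this is not a stable cutset at once.
   Let [C] be the component of [w] in [V - Q - z] and [H] the rest.  [solid_ge] applied
   to [H + x] with its neighbourhood and to [C] gives two bounds whose sum exceeds
   [2n - 3]: each neighbour of [z] lost in the first is gained in the second. *)
Lemma no_far_region x y z w p q Q : gadget x y z w p q -> y \in Q ->
  Q \subset V :\: [set x; w; z] -> stb (nb (V :\: [set x; w; z]) Q) ->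
  p \notin Q :|: nb (V :\: [set x; w; z]) Q ->
  q \notin Q :|: nb (V :\: [set x; w; z]) Q -> False.
Proof.
set W := V :\: _.
(* Restricting [Q] to the component of [y] only shrinks [Q] and its neighbourhood. *)
wlog cQ : Q / conn Q.
  move=> IH g yQ sQ stQ pQ qQ; have [C [yC sC cC nC]] := component_exists yQ.
  have sub : nb W C \subset nb W Q.
    apply/subsetP => b /nbP[bW bC [a aC ab]]; apply/nbP; split=> //.
      apply/negP => bQ; have := nb0P nC aC; move=> /(_ b); rewrite inE bQ bC ab.
      by move=> /(_ isT).
    by exists a; rewrite // (subsetP sC).
  have sub' : C :|: nb W C \subset Q :|: nb W Q by apply: setUSS.
  apply: (IH C) => //; first exact: subset_trans sC sQ.
  - exact: stbS sub stQ.
  - by apply: contra pQ; apply: (subsetP sub').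
  - by apply: contra qQ; apply: (subsetP sub').
move=> g yQ sQ stQ pQ qQ.
have [[xV yV zV wV [pV qV]] [[xy xz xw wp wq] [[yz pq nxy nxz nxw] [[nwp nwq nxp nxq npq]
  [nyz nyw nzw [nyp nyq nzp nzq]]]]]] := gadgetE g.
have [_ _ Nx Nw _] := g.
have inW u : (u \in W) = [&& u \in V, u != x, u != w & u != z].
  by rewrite !inE !negb_or andbC -!andbA.
have inQ u : u \in Q -> [&& u \in V, u != x, u != w & u != z].
  by move=> /(subsetP sQ); rewrite inW.
have [pnQ pnN] : p \notin Q /\ p \notin nb W Q by apply/andP; rewrite -negb_or -in_setU.
have [qnQ qnN] : q \notin Q /\ q \notin nb W Q by apply/andP; rewrite -negb_or -in_setU.
have xQ : x \notin Q by apply/negP => /inQ; rewrite eqxx andbF.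
have wQ : w \notin Q by apply/negP => /inQ; rewrite eqxx !andbF.
have zQ : z \notin Q by apply/negP => /inQ; rewrite eqxx !andbF.
pose A := z |: Q.
have cA : conn A.
  by rewrite /A setUC; apply: conn_addnb => // s /set1P->; exists y.
have sA : A \subset V.
  by rewrite subUset sub1set zV; apply/subsetP => u /inQ/and4P[].
have wX : w \in V :\: A by rewrite !inE wV negb_or eq_sym nzw wQ.
have [C [wC sC cC nC]] := component_exists wX.
have hC := nb0P nC.
have inC u : u \in C -> [/\ u \in V, u != z & u \notin Q].
  by move=> /(subsetP sC); rewrite !inE negb_or => /andP[/andP[]].
have addC a b : a \in C -> b \in V -> b != z -> b \notin Q -> e a b -> b \in C.
  move=> aC bV bz bQ ab; apply/negPn/negP => bC.
  by have := hC a b aC; rewrite !inE bC bV negb_or bz bQ ab => /(_ isT).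
have xC : x \in C by apply: (addC w); rewrite // eC.
have pC : p \in C by apply: (addC w); rewrite // eq_sym.
have qC : q \in C by apply: (addC w); rewrite // eq_sym.
pose H := V :\: (z |: C).
have inH u : u \in H = [&& u \in V, u != z & u \notin C].
  by rewrite !inE negb_or andbC andbA.
pose N := nb W Q :&: C.
(* A vertex of [H] adjacent to [C] lies in [Q], since [C] is a component of [V :\: A]. *)
have HC a c : a \in H -> c \in C -> e a c -> c = x \/ c \in N.
  rewrite inH => /and3P[aV az aC] cC' ac.
  have aQ : a \in Q.
    by apply/negPn/negP => aQ; case/negP: aC; apply: (addC c); rewrite // eC.
  have [cV cz cQ'] := inC c cC'; have [->|cx] := eqVneq c x; [by left|right].
  rewrite in_setI cC' andbT; apply/nbP; split=> //; last by exists a.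
  rewrite inW cV cx cz andbT; apply/eqP => cw; move: ac; rewrite cw eC Nw // !inE.
  by move=> /or3P[]/eqP E; move: aQ; rewrite E ?(negPf xQ) ?(negPf pnQ) ?(negPf qnQ).
have stN : stb N by apply: stbS stQ; apply: subsetIl.
have xN : x \notin N.
  by rewrite in_setI negb_and; apply/orP; left; apply/nbP => -[]; rewrite inW eqxx andbF.
have wN : w \notin N.
  by rewrite in_setI negb_and; apply/orP; left; apply/nbP => -[]; rewrite inW eqxx !andbF.
have zN : z \notin N.
  by rewrite in_setI negb_and; apply/orP; left; apply/nbP => -[]; rewrite inW eqxx !andbF.
have pN : p \notin N by rewrite in_setI (negPf pnN).
have qN : q \notin N by rewrite in_setI (negPf qnN).
have yN : y \notin N by rewrite in_setI; apply/negP => /andP[/nbP[_]]; rewrite yQ.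
have sNC : N \subset C by apply: subsetIr.
have Nxu u : u \in V -> u != y -> u != z -> u != w -> e x u = false.
  by move=> uV' uy uz uw; rewrite Nx // !inE (negPf uy) (negPf uz) (negPf uw).
have Nwu u : u \in V -> u != x -> u != p -> u != q -> e w u = false.
  by move=> uV' ux up uq; rewrite Nw // !inE (negPf ux) (negPf up) (negPf uq).
have inN u : u \in N -> [/\ u \in V, u != z & [/\ u != x, u != w, u != y, u != p & u != q]].
  move=> uN; have [uV' uz _] := inC u (subsetP sNC u uN).
  by split=> //; split; apply: contraTneq uN => ->.
have dxN : dd [set x] N = 0.
  by apply: dd_eq0 => a u /set1P-> /inN[uV' uz [_ uw uy _ _]]; rewrite Nxu.
have dwN : dd [set w] N = 0.
  by apply: dd_eq0 => a u /set1P-> /inN[uV' uz [ux _ _ up uq]]; rewrite Nwu.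
have nwz : e w z = false by rewrite Nwu // eq_sym.
have wx : e w x by rewrite eC.
have neN : ne N = 0 by apply/eqP; rewrite -stb_ne.
pose K := w |: (x |: (z |: N)).
have xzN : x \notin z |: N by rewrite !in_setU1 negb_or nxz.
have wxzN : w \notin x |: (z |: N).
  by rewrite !in_setU1 !negb_or wN eq_sym nxw eq_sym nzw.
have neK : ne K = dd [set z] N + 2.
  rewrite /K neU1 // neU1 // neU1 // !ddU1 // dxN dwN neN xz wx nwz; clear; lia.
have cK : #|K| = #|N| + 3.
  by rewrite /K cardsU1 wxzN cardsU1 xzN cardsU1 zN; clear; lia.
have dHK : [disjoint H & K].
  apply: disjointP => u; rewrite inH => /and3P[uV' uz uC].
  rewrite !in_setU1 (negPf uz) => /or3P[/eqP E|/eqP E|/(subsetP sNC)]; last by rewrite (negPf uC).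
    by rewrite E wC in uC.
  by rewrite E xC in uC.
pose Z := H :|: K.
(* This order shows [Z] connected: [V :\: C] is, [x] is attached through [y], [N] through [Q], and
   [w] through [x]. *)
have EZ : Z = ((V :\: C) :|: (x |: N)) :|: [set w].
  apply/setP => u; rewrite /Z /K /H !(in_setU, in_setD, in_set1).
  have [->|uz] := eqVneq u z; last first.
    by rewrite /=; case: (u \in V); case: (u \in C); case: (u \in N); case: (_ == x); case: (_ == w).
  by rewrite zV /= orbT !orbT; have -> : z \notin C; [apply/negP => /inC[_]; rewrite eqxx|].
have A0 : A != set0 by apply/set0Pn; exists z; rewrite setU11.
have C0 : C != set0 by apply/set0Pn; exists w.
have cVC : conn (V :\: C) by apply: conn_compl cA sA sC nC C0 A0; apply: solid_conn.
have yH : y \in V :\: C by rewrite inE yV andbT; apply/negP => /inC[_ _]; rewrite yQ.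
have QH : Q \subset V :\: C.
  by apply/subsetP => u uQ; have /and4P[uV' _ _ _] := inQ u uQ; rewrite inE uV' andbT;
     apply/negP => /inC[_ _]; rewrite uQ.
have cZ : conn Z.
  rewrite EZ; apply: conn_addnb; last first.
    by move=> s /set1P->; exists x; rewrite // !inE eqxx orbT.
  apply: conn_addnb => // s; rewrite in_setU1 => /predU1P[->|].
    by exists y; rewrite // eC.
  rewrite in_setI => /andP[/nbP[_ _ [a aQ as_]] _]; exists a => //.
  exact: (subsetP QH).
have cZ2 : #|Z| = #|H| + #|K| by rewrite cardU.
have neZ : ne Z = ne H + ne K + dd H K by rewrite neU.
have sZ : Z \subset V.
  rewrite subUset subsetDl !subUset !sub1set wV xV zV /=.
  by apply/subsetP => u /inN[].
have pZ : Z \proper V.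
  rewrite properE sZ; apply/subsetPn; exists p => //.
  by rewrite !in_setU !in_set1 inH pC !andbF /= !negb_or eq_sym nwp eq_sym nxp eq_sym nzp pN.
(* [x] stays out of [M] because its neighbours [y], [z], [w] are all in [Z]; this saves the one unit
   needed at the end. *)
pose M := w |: (z |: N).
have sM : M \subset Z.
  by apply/subsetP => u; rewrite !in_setU !in_set1 => /or3P[]->; rewrite !orbT.
have cM : #|M| = #|N| + 2.
  by rewrite /M cardsU1 in_setU1 negb_or eq_sym nzw wN cardsU1 zN; clear; lia.
have boundZ := @solid_ge V Z M sV pZ cZ sM.
have {}boundZ : 2 * #|Z| <= ne Z + #|M| + 1.
  apply: boundZ => a b /setDP[aZ aM] /setDP[bV bZ]; apply/negP => ab.
  move: bZ; rewrite !in_setU !in_set1 !negb_or => /and5P[bH bw bx bz bN].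
  have bC : b \in C by apply/negPn; move: bH; rewrite inH bV bz.
  move: aZ aM; rewrite !in_setU !in_set1 !negb_or => /orP[aH|] => [_|].
    by have [E|E] := HC a b aH bC ab; [rewrite E eqxx in bx|rewrite E in bN].
  move=> + /and3P[aw az aN]; rewrite (negPf aw) (negPf az) (negPf aN) !orbF /= => /eqP ax.
  move: ab; rewrite ax Nxu //; apply: contraTneq bC => ->.
  by apply/negP => /inC[_ _]; rewrite yQ.
pose F := [set c in C | e z c].
pose MC := N :|: F.
have cF : #|F| = dd [set z] C by rewrite dd1E.
have cNF : #|N :&: F| = dd [set z] N.
  rewrite dd1E; apply: eq_card => u; rewrite in_setI [RHS]inE.
  case uN : (u \in N) => //=; rewrite inE (subsetP sNC) //.
have cMC := cardsUI N F.
have sMC : MC \subset C by rewrite subUset sNC; apply/subsetP => u; rewrite inE => /andP[].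
have pCV : C \proper V.
  rewrite properE; apply/andP; split; first by apply/subsetP => u /inC[].
  by apply/subsetPn; exists z => //; apply/negP => /inC[_]; rewrite eqxx.
have boundC : 2 * #|C| <= ne C + #|MC| + 1.
  apply: (solid_ge sV pCV cC sMC) => c a /setDP[cC' cMC'] /setDP[aV aC].
  apply/negP => ca; case/negP: cMC'; apply/setUP.
  have [az|az] := eqVneq a z; first by right; rewrite inE cC' -az eC.
  have aH : a \in H by rewrite inH aV az.
  have ac : e a c by rewrite eC.
  have [->|cN] := HC a c aH cC' ac; last by left.
  by right; rewrite inE xC eC.
have zHC : z \notin H :|: C.
  by rewrite in_setU inH eqxx andbF; apply/negP => /inC[_]; rewrite eqxx.
have EV : V = z |: (H :|: C).
  apply/setP => u; rewrite in_setU1 in_setU inH; have [->//|uz] := eqVneq u z.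
  by rewrite /=; case uC : (u \in C); rewrite ?orbT ?orbF ?andbT //; have [] := inC u uC.
have dHC : [disjoint H & C] by apply: disjointP => u; rewrite inH => /and3P[_ _ /negPf->].
have neV : ne V = ne H + ne C + dd H C + dd [set z] H + dd [set z] C.
  by rewrite {1}EV neU1 // neU // ddUr // !addnA.
have cV : #|V| = (#|H| + #|C|).+1 by rewrite {1}EV cardsU1 zHC cardU.
have dHKE : dd H K = dd H (x |: N) + dd [set z] H.
  have dHw : dd H [set w] = 0.
    apply: dd_eq0 => u a; rewrite inH => /and3P[uV' uz uC] /set1P->.
    by rewrite eC Nwu //; apply: contraNneq uC => ->.
  rewrite /K (setUCA [set x]) ddUr ?disjoints1; last by rewrite (setUCA [set z]).
  rewrite dHw add0n ddUr ?disjoints1 ?in_setU1 ?negb_or 1?eq_sym ?nxz //.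
  by rewrite addnC (ddC H [set z]).
have dHCE : dd H C = dd H (x |: N).
  have sxN : x |: N \subset C by rewrite subUset sub1set xC.
  have -> : C = (x |: N) :|: (C :\: (x |: N)) by rewrite -{1}(setID C (x |: N)) (setIidPr sxN).
  rewrite ddUr ?disjDr // [X in _ + X]dd_eq0 ?addn0 // => a c aH /setDP[cC' cN].
  apply/negP => ac; case/negP: cN; rewrite in_setU1.
  by have [->|->] := HC a c aH cC' ac; rewrite ?eqxx ?orbT.
(* In the sum of [boundZ] and [boundC] the terms [#|N|] and [dd [set z] N] cancel. What remains is
   [2 * (#|H| + #|C|) <= ne V], that is, at least [2 * #|V| - 2] edges. *)
by rewrite -/MC in cMC; nlia.
Qed.

(** If no such set existed, [separation] with [P = [set y]], [B = [set p; q]] and [k = 3] would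
    produce what [no_far_region] forbids. *)
Lemma tight_set x y z w p q : gadget x y z w p q -> ~~ e y p -> ~~ e y q ->
  exists X, [/\ y \in X, p \in X, q \in X, X \subset V :\: [set x; w; z]
    & 2 * #|X| <= ne X + 4].
Proof.
move=> g nyp nyq.
have [[xV yV zV wV [pV qV]] [[xy xz xw wp wq] [[yz pq nxy nxz nxw] [[nwp nwq nxp nxq npq]
  [nyz nyw nzw [neyp neyq nzp nzq]]]]]] := gadgetE g.
set W := V :\: _.
have [/exists_inP[X yX /and4P[pX qX sX h]]|/exists_inPn none] := boolP
    [exists X in [pred X : {set T} | y \in X],
      [&& p \in X, q \in X, X \subset W & 2 * #|X| <= ne X + 4]].
  by exists X.
exfalso.
have inW u : (u \in W) = [&& u \in V, u != x, u != w & u != z].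
  by rewrite !inE !negb_or andbC -!andbA.
have yW : y \in W by rewrite inW yV ![y == _]eq_sym nxy -[w == y]eq_sym nyw eq_sym nyz.
have pW : p \in W by rewrite inW pV ![p == _]eq_sym nxp nwp nzp.
have qW : q \in W by rewrite inW qV ![q == _]eq_sym nxq nwq nzq.
have [|||X sX sXW|Q [yQ sQ stQ dQ]] := @separation W [set y] [set p; q] 3.
- by rewrite sub1set.
- by apply/subsetP => u /set2P[]->; rewrite !in_setD1 ?pW ?qW andbT eq_sym.
- by rewrite cards2 npq neU1 ?in_set1 // ne1 dd11 pq.
- have [pX qX] : p \in X /\ q \in X by split; apply: (subsetP sX); rewrite !inE eqxx ?orbT.
  have yX : y \notin X by apply/negP => /(subsetP sXW); rewrite !inE eqxx.
  have -> : #|X :&: nb W [set y]| = dd [set y] X.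
    rewrite dd1E; apply: eq_card => u; rewrite in_setI [RHS]inE.
    have [uX|//] := boolP (u \in X); rewrite /=.
    have /setDP[uW uy] := subsetP sXW u uX.
    by apply/nbP/idP => [[_ _ [v /set1P->]]//|yu]; split=> //; exists y; rewrite ?set11.
  have := none (y |: X); rewrite inE setU11 => /(_ isT).
  rewrite !inE pX qX !orbT subUset sub1set yW (subset_trans sXW (subsetDl _ _)) /=.
  by rewrite -ltnNge neU1 // cardsU1 yX => ?; nlia.
rewrite sub1set in yQ.
have dis u : u \in [set p; q] -> u \notin Q :|: nb W Q.
  by move=> ?; rewrite (disjointFr dQ).
by apply: (no_far_region g yQ sQ stQ); apply: dis; rewrite !inE eqxx ?orbT.
Qed.

(** The intersection contains the nonadjacent pair [y], [p] and is therefore sparse, so the union is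
    tight. If the union were smaller than [V - x - w], adding [x] (two edges, to [y] and [z]) and
    [w] (three, to [x], [p], [q]) would give a proper set violating [sparser]. *)
Lemma tight_cover x y z w p q X1 X2 : gadget x y z w p q -> ~~ e y p ->
    X1 \subset V :\: [set x; w] -> X2 \subset V :\: [set x; w] ->
    y \in X1 -> y \in X2 -> p \in X1 -> p \in X2 ->
    z \in X1 :|: X2 -> q \in X1 :|: X2 ->
    2 * #|X1| <= ne X1 + 4 -> 2 * #|X2| <= ne X2 + 4 ->
  X1 :|: X2 = V :\: [set x; w] /\ 2 * #|X1 :|: X2| <= ne (X1 :|: X2) + 4.
Proof.
move=> g nyp s1 s2 y1 y2 p1 p2 zU qU t1 t2.
have [[xV yV zV wV [pV qV]] [[xy xz xw wp wq] [[yz pq nxy nxz nxw] [[nwp nwq nxp nxq npq]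
  [nyz nyw nzw [neyp neyq nzp nzq]]]]]] := gadgetE g.
have sU : X1 :|: X2 \subset V :\: [set x; w] by rewrite subUset s1.
have xH : x \notin V :\: [set x; w] by rewrite !inE eqxx.
have wH : w \notin V :\: [set x; w] by rewrite !inE eqxx orbT.
have xU := contra (subsetP sU x) xH; have wU := contra (subsetP sU w) wH.
have pI : X1 :&: X2 \proper V.
  rewrite properE (subset_trans (subsetIl _ _) (subset_trans s1 (subsetDl _ _))) /=.
  apply/subsetPn; exists x => //; apply: contra xU.
  by rewrite inE => /andP[? _]; rewrite inE; apply/orP; left.
have yI : y \in X1 :&: X2 by rewrite inE y1.
have pI' : p \in X1 :&: X2 by rewrite inE p1.
have hI := sparse_nonadjacent pI yI pI' neyp nyp.
have sup := ne_supermod X1 X2; have cU := cardsUI X1 X2.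
have tU : 2 * #|X1 :|: X2| <= ne (X1 :|: X2) + 4 by nlia.
split=> //; apply/eqP/negPn/negP => nU.
have xyzU : 2 <= dd [set x] (X1 :|: X2).
  have -> : 2 = dd [set x] (y |: [set z]) by rewrite ddU1 ?in_set1 // dd11 xy xz.
  by apply: dd_sub => //; rewrite subUset !sub1set zU inE y1.
have wxpq : 3 <= dd [set w] (x |: (X1 :|: X2)).
  have -> : 3 = dd [set w] (x |: (p |: [set q])).
    by rewrite !ddU1 ?dd11 ?inE ?negb_or ?nxp // wp wq eC xw.
  by apply: dd_sub => //; rewrite setUS // subUset !sub1set qU inE p1.
have wxU : w \notin x |: (X1 :|: X2) by rewrite in_setU1 negb_or eq_sym nxw.
have pS : w |: (x |: (X1 :|: X2)) \proper V.
  have sUV := subset_trans sU (subsetDl _ _).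
  rewrite properEneq; apply/andP; split; last by do 2 rewrite subUset sub1set ?wV ?xV /=.
  apply: contraNneq nU => E; rewrite eqEsubset sU /=; apply/subsetP => u.
  by rewrite -E !in_setD !in_setU1 !in_set1 => /andP[] /norP[/negPf-> /negPf->].
have c4 : #|w |: (x |: (X1 :|: X2))| = #|X1 :|: X2| + 2.
  by rewrite cardsU1 wxU cardsU1 xU; clear; lia.
have U2 : 2 <= #|X1 :|: X2|.
  have -> : 2 = #|[set y; p]| by rewrite cards2 neyp.
  by apply/subset_leq_card; rewrite subUset !sub1set !inE y1 p1.
have := sparser sV hV usV pS; rewrite c4 neU1 // neU1 // => h.
have {}h := h (leq_add U2 (leqnn 2)).
by nlia.
Qed.

(** With four common vertices, [sparser] applies to union and intersection, and the edge [yz] across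
    the differences exceeds the bound. *)
Lemma tight_inter X1 X2 x y z : x \in V -> X1 \subset V :\ x -> X2 \subset V :\ x ->
    y \in X1 :\: X2 -> z \in X2 :\: X1 -> e y z ->
    2 * #|X1| <= ne X1 + 4 -> 2 * #|X2| <= ne X2 + 4 -> #|X1 :&: X2| <= 3.
Proof.
move=> xV s1 s2 yD zD yz t1 t2; rewrite leqNgt; apply/negP => c4.
have pr X : X \subset V :\ x -> X \proper V.
  by move=> sX; apply: sub_proper_trans sX _; rewrite properD1.
have h1 : ne (X1 :&: X2) + 4 <= 2 * #|X1 :&: X2|.
  by apply: (sparser sV hV usV) => //; apply: pr; apply: subset_trans s1; apply: subsetIl.
have h2 : ne (X1 :|: X2) + 4 <= 2 * #|X1 :|: X2|.
  apply: (sparser sV hV usV); first by apply: pr; rewrite subUset s1.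
  apply: leq_trans c4 _; apply: subset_leq_card.
  by apply: subset_trans (subsetIl _ _) (subsetUl _ _).
have := ne_supermod X1 X2; have := cardsUI X1 X2; have := dd_gt0 yD zD yz.
by move=> *; nlia.
Qed.

Lemma gadget_crossed x y z w p q : gadget x y z w p q ->
  [|| e y p, e y q, e z p | e z q].
Proof.
move=> g; apply/negPn/negP; rewrite !negb_or => /and4P[nyp nyq nzp nzq].
have [[xV yV zV wV [pV qV]] [[xy xz xw wp wq] [[yz pq nxy nxz nxw] [[nwp nwq nxp nxq npq]
  [nyz nyw nzw [neyp neyq nezp nezq]]]]]] := gadgetE g.
have gl := gadget_swapl g; have gr := gadget_swapr g; have gf := gadget_flip g.
have glr := gadget_swapl gr; have gfl := gadget_swapl gf.
have [npy npz] : ~~ e p y /\ ~~ e p z by rewrite !(eC p).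
have [nqy nqz] : ~~ e q y /\ ~~ e q z by rewrite !(eC q).
(* Each of the four sets is named after the vertex it favours: it contains that vertex and the
   opposite pair, but not the partner of that vertex. *)
have [Y [yY pY qY sY tY]] := tight_set g nyp nyq.
have [Z [zZ pZ qZ sZ tZ]] := tight_set gl nzp nzq.
have [P [pP yP zP sP tP]] := tight_set gf npy npz.
have [Q [qQ yQ zQ sQ tQ]] := tight_set gfl nqy nqz.
pose H := V :\: [set x; w].
have sub2 X a : X \subset V :\: [set x; w; a] -> X \subset H.
  by move=> sX; apply: subset_trans sX _; rewrite setDS // subsetUl.
have sub2' X a : X \subset V :\: [set w; x; a] -> X \subset H.
  by rewrite [[set w; x]]setUC; apply: sub2.
have out X (a b c : T) : X \subset V :\: [set a; b; c] -> c \notin X.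
  by move=> sX; apply/negP => /(subsetP sX); rewrite !inE eqxx !orbT.
have sub1 X : X \subset H -> X \subset V :\ x.
  by move=> sX; apply: subset_trans sX _; rewrite setDS // subsetUl.
have [[[sYH sZH] sPH] sQH] := (sub2 _ _ sY, sub2 _ _ sZ, sub2' _ _ sP, sub2' _ _ sQ).
have [[[zY yZ] qP] pQ] := (out _ _ _ _ sY, out _ _ _ _ sZ, out _ _ _ _ sP, out _ _ _ _ sQ).
have c1 : #|Y :&: Z| <= 3.
  by apply: (@tight_inter Y Z x y z); rewrite ?sub1 // inE ?yY ?zZ ?zY ?yZ.
have c2 : #|P :&: Q| <= 3.
  by apply: (@tight_inter P Q x p q); rewrite ?sub1 // inE ?pP ?qQ ?qP ?pQ.
have [YP tH] : Y :|: P = H /\ 2 * #|Y :|: P| <= ne (Y :|: P) + 4.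
  by apply: (tight_cover g) => //; rewrite inE ?zP ?qY ?orbT.
have [YQ _] : Y :|: Q = H /\ 2 * #|Y :|: Q| <= ne (Y :|: Q) + 4.
  by apply: (tight_cover gr) => //; rewrite inE ?zQ ?pY ?orbT.
have [ZP _] : Z :|: P = H /\ 2 * #|Z :|: P| <= ne (Z :|: P) + 4.
  by apply: (tight_cover gl) => //; rewrite inE ?yP ?qZ ?orbT.
have [ZQ _] : Z :|: Q = H /\ 2 * #|Z :|: Q| <= ne (Z :|: Q) + 4.
  by apply: (tight_cover glr) => //; rewrite inE ?yQ ?pZ ?orbT.
(* A vertex of [H] that misses one of [Y], [Z] lies in both [P] and [Q], so [H] is covered by two
   sets of size at most 3. *)
have H6 : #|H| <= 6.
  apply: leq_trans (_ : #|(Y :&: Z) :|: (P :&: Q)| <= 6); last first.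
    by have := cardsUI (Y :&: Z) (P :&: Q); nlia.
  apply/subset_leq_card/subsetP => u uH; rewrite !inE.
  have : u \in Y :|: P by rewrite YP. have : u \in Y :|: Q by rewrite YQ.
  have : u \in Z :|: P by rewrite ZP. have : u \in Z :|: Q by rewrite ZQ.
  by rewrite !in_setU; do 4 case: (u \in _).
rewrite YP in tH.
pose R := y |: (z |: (p |: [set q])).
have cR : #|R| = 4.
  by rewrite !cardsU1 cards1 !inE !negb_or nyz neyp neyq nezp nezq npq.
have neR : ne R = 2.
  rewrite !neU1 ?ddU1 ?dd11 ?ne1 ?inE ?negb_or ?nyz ?neyp ?neyq ?nezp ?nezq ?npq //.
  by rewrite yz pq (negPf nyp) (negPf nyq) (negPf nzp) (negPf nzq).
have sR : R \subset H by rewrite !subUset !sub1set -YP !inE yY zP pY qY !orbT.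
have dRO := disjDr R H.
have EH : H = R :|: (H :\: R) by rewrite -{1}(setID H R) (setIidPr sR).
have cH := cardU dRO; rewrite -EH in cH; have neH := neU dRO; rewrite -EH in neH.
set O := H :\: R in dRO EH cH neH.
have neO : ne O <= 1.
  have [O1|O2] := leqP #|O| 1; first by rewrite ne_small.
  have sOV : O \subset V by apply: subset_trans (subsetDl _ _) (subsetDl _ _).
  by have := sparse sV hV sOV O2; nlia.
(* The edges [yz] and [pq] already have the apexes [x] and [w], so a vertex of [O] sees at most one
   end of each. Then [H] has at most [2 + 1 + 2 * #|O|] edges, one fewer than its tightness
   requires. *)
have dO : dd R O <= \sum_(o in O) 2.
  rewrite ddC dd_sum; apply: leq_sum => o /setDP[/setDP[oV]].
  rewrite !inE negb_or => /andP[ox ow] oR.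
  have tri a b c : a \in V -> b \in V -> c \in V -> e a b -> e a c -> e b c -> o != a ->
      e o b + e o c <= 1.
    move=> aV bV cV ab ac bc oa; case ob : (e o b); case oc : (e o c) => //.
    by case/eqP: oa; apply: (one_triangle oV aV bV cV).
  move: oR; rewrite !negb_or => /and4P[oy oz op oq].
  rewrite !ddU1 ?dd11 ?inE ?negb_or ?nyz ?neyp ?neyq ?nezp ?nezq ?npq //.
  have := tri x y z xV yV zV xy xz yz ox; have := tri w p q wV pV qV wp wq pq ow.
  by clear; lia.
rewrite sum_nat_const in dO.
by nlia.
Qed.

(** [one_triangle] excludes [yq] and [zp], and a missing [zq] would yield a stable cutset. The nine
    edges then found on six vertices attain [2 * 6 - 3], so by [sparser] these vertices are all of
    [V]. *)
Lemma gadget_prism x y z w p q : gadget x y z w p q -> e y p ->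
  [/\ V = [set x; y; z] :|: [set w; p; q], e z q, ~~ e y q & ~~ e z p].
Proof.
move=> g yp.
have [[xV yV zV wV [pV qV]] [[xy xz xw wp wq] [[yz pq nxy nxz nxw] [[nwp nwq nxp nxq npq]
  [nyz nyw nzw [neyp neyq nezp nezq]]]]]] := gadgetE g.
have [_ _ Nx Nw _] := g.
have [zy py qp] : [/\ e z y, e p y & e q p] by rewrite !(eC _ y) (eC q).
have nyq : ~~ e y q.
  apply/negP => yq; case/eqP: nyw.
  exact: (one_triangle yV wV pV qV).
have nzp : ~~ e z p.
  apply/negP => zp; case/eqP: nxp; have [px pz] : e p y /\ e p z by rewrite !(eC p).
  exact: (one_triangle xV pV yV zV).
have zq : e z q.
  apply/negPn/negP => nzq; pose W := V :\: [set x; w].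
  have inW u : (u \in W) = [&& u \in V, u != x & u != w].
    by rewrite !inE negb_or andbC.
  have zW : z \in W by rewrite inW zV eq_sym nxz nzw.
  have qW : q \in W by rewrite inW qV ![q == _]eq_sym nxq nwq.
  have pW : W \proper V.
    by rewrite properE subsetDl; apply/subsetPn; exists x; rewrite // inW eqxx andbF.
  have [Q [zQ sQ stQ qQ qN]] := separate pW zW qW nezq nzq.
  set N := nb W Q in stQ qN.
  have inQ u : u \in Q -> [&& u \in V, u != x & u != w] by move=> /(subsetP sQ); rewrite inW.
  have sQV : Q \subset V by apply: subset_trans sQ (subsetDl _ _).
  have xQ : x \notin Q by apply/negP => /inQ; rewrite eqxx andbF.
  have wQ : w \notin Q by apply/negP => /inQ; rewrite eqxx !andbF.
  have xN : x \notin N by apply/nbP => -[]; rewrite inW eqxx andbF.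
  have wN : w \notin N by apply/nbP => -[]; rewrite inW eqxx !andbF.
  have closed a b : a \in Q -> b \in V -> b != x -> b != w -> e a b -> b \notin Q -> b \in N.
    by move=> aQ bV bx bw ab bQ; apply/nbP; rewrite inW bV bx bw; split=> //; exists a.
  have pQ : p \notin Q.
    by apply/negP => pQ; case/negP: qN; apply: (closed p); rewrite // eq_sym.
  have zN : z \notin N by apply/nbP => -[_]; rewrite zQ.
  have stU a : {in N, forall b, ~~ e a b} -> stb (a |: N).
    move=> h; apply/stbP => b c; rewrite !in_setU1.
    move=> /predU1P[->|bN] /predU1P[->|cN]; first by rewrite e0.
    - exact: h.
    - by rewrite eC h.
    - exact: (stbP _ stQ).
  (* If [y] is in [Q], the cutset lies in [x |: N], which is stable since [N] avoids [y], [z], [w].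
     If not, [y] is in [N], so [p] is not; then [x] joins [Q] and the cutset lies in [w |: N]. *)
  have [yQ|yQ] := boolP (y \in Q).
    have yN : y \notin N by apply/nbP => -[_]; rewrite yQ.
    have sub : nb V Q \subset x |: N.
      apply/subsetP => b /nbP[bV bQ [a aQ ab]]; rewrite in_setU1; have [//|bx] := eqVneq b x.
      apply: (closed a b) => //; apply: contraTneq ab => ->; rewrite eC Nw ?(subsetP sQV) //.
      rewrite !inE; apply/negP => /or3P[]/eqP E; move: aQ; rewrite E ?(negPf xQ) //.
        by rewrite (negPf pQ).
      by rewrite (negPf qQ).
    apply: (@solid_cut V Q q sV) => //; first by apply/set0Pn; exists z.
      apply: stbS sub _; apply: stU => b bN; have /setDP[/setDP[bV _] _] : b \in W :\: Q.
        by have /nbP[bW bQ _] := bN; rewrite inE bQ.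
      rewrite Nx // !inE; apply/negP => /or3P[]/eqP E; move: bN; rewrite E ?(negPf yN) //.
        by rewrite (negPf zN).
      by rewrite (negPf wN).
    by apply: contra qN => /(subsetP sub); rewrite in_setU1 eq_sym (negPf nxq).
  have yN : y \in N by apply: (closed z); rewrite // eq_sym.
  have pN : p \notin N by apply/negP => pN; have := stbP _ stQ y p yN pN; rewrite yp.
  have sub : nb V (x |: Q) \subset w |: N.
    apply/subsetP => b /nbP[bV]; rewrite !in_setU1 negb_or => /andP[bx bQ] [a].
    rewrite in_setU1; have [//|bw] := eqVneq b w; rewrite /=.
    move=> /predU1P[->|aQ] ab; last exact: (closed a).
    move: ab bQ bw; rewrite Nx // => + + bw.
    by rewrite in_cons in_cons in_cons in_nil (negPf bw) => /or3P[/eqP->|/eqP->|//] //; rewrite ?zQ.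
  apply: (@solid_cut V (x |: Q) q sV) => //.
  - by rewrite subUset sub1set xV.
  - by apply/set0Pn; exists x; rewrite setU11.
  - apply: stbS sub _; apply: stU => b bN; have /setDP[/setDP[bV _] _] : b \in W :\: Q.
      by have /nbP[bW bQ _] := bN; rewrite inE bQ.
    rewrite Nw // !inE; apply/negP => /or3P[]/eqP E; move: bN; rewrite E ?(negPf xN) //.
      by rewrite (negPf pN).
    by rewrite (negPf qN).
  - by rewrite in_setU1 negb_or eq_sym nxq.
  - by apply: contra qN => /(subsetP sub); rewrite in_setU1 eq_sym (negPf nwq).
split=> //; apply/esym/eqP/negPn/negP => nU.
pose U := x |: (y |: (z |: (w |: (p |: [set q])))).
have EU : [set x; y; z] :|: [set w; p; q] = U by rewrite /U !setUA.
have sU : U \subset V by rewrite !subUset !sub1set xV yV zV wV pV qV.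
have pU : U \proper V by rewrite properEneq sU -EU nU.
have cU : #|U| = 6.
  rewrite !cardsU1 cards1 !inE !negb_or nxy nxz nxw nxp nxq nyz nyw neyp neyq nzw nezp nezq.
  by rewrite nwp nwq npq.
have neU9 : 9 <= ne U.
  rewrite !neU1 ?ddU1 ?dd11 ?ne1 ?inE ?negb_or ?nxy ?nxz ?nxw ?nxp ?nxq ?nyz ?nyw ?neyp ?neyq
    ?nzw ?nezp ?nezq ?nwp ?nwq ?npq //.
  by rewrite xy xz xw yz yp zq wp wq pq; clear; lia.
by have := sparser sV hV usV pU; rewrite cU => /(_ isT) ?; nlia.
Qed.

End Unsplit.

(** * The class of glued triangles and prisms *)

(** A set missing [C] has the same neighbours in [A] and in [V]. If [Q] meets the clique [C], the
    region [R] beyond its neighbourhood misses [C] and can replace [Q]. *)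
Lemma solid_piece V A C : solid V -> A \proper V -> clq C ->
  {in A :\: C & V :\: A, forall x y, ~~ e x y} -> solid A.
Proof.
move=> sV pA cC hC Q sQ Q0 stQ; have sA := proper_sub pA.
apply/eqP/negPn/negP => nE.
have key R : R \subset A -> R != set0 -> {in R, forall x, x \notin C} ->
    nb A R \subset nb A Q -> False.
  move=> sR R0 RC sN.
  have sub : nb V R \subset nb A R.
    apply/subsetP => b /nbP[bV bR [a aR ab]]; apply/nbP; split=> //; last by exists a.
    apply/negPn/negP => bA; have := hC a b; rewrite !in_setD RC // bA bV (subsetP sR) // ab.
    by move=> /(_ isT isT).
  have E := sV R (subset_trans sR sA) R0 (stbS (subset_trans sub sN) stQ).
  have : V \subset A by rewrite -E subUset sR (subset_trans sub (nbS _ _)).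
  by move=> /(proper_sub_trans pA); rewrite properxx.
have [CQ|[c]] := set_0Vmem (C :&: Q).
  apply: (key Q) => // x xQ; apply/negP => xC.
  by move: (in_set0 x); rewrite -CQ inE xC xQ.
rewrite in_setI => /andP[cC' cQ]; pose R := A :\: (Q :|: nb A Q).
have sR : R \subset A by apply: subsetDl.
have QR x y : x \in Q -> y \in R -> ~~ e x y.
  move=> xQ /setDP[yA]; rewrite in_setU negb_or => /andP[yQ yN]; apply: contra yN => xy.
  by apply/nbP; split=> //; exists x.
apply: (key R) => //.
- rewrite setD_eq0; apply: contra nE => s; rewrite eqEsubset s.
  by rewrite subUset sQ nbS.
- move=> x xR; apply/negP => xC; have := QR c x cQ xR; rewrite cC //.
  apply/eqP => E; move: xR; rewrite -E => /setDP[_]; rewrite in_setU cQ //.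
- apply/subsetP => y /nbP[yA yR [x xR xy]].
  have yQ : y \notin Q by apply/negP => yQ; have := QR y x yQ xR; rewrite eC xy.
  by move: yR; rewrite in_setD yA andbT negbK in_setU (negPf yQ).
Qed.

Lemma solid_triangle V : solid V -> #|V| = 3 -> clq V.
Proof.
move=> sV V3 x y xV yV xy; apply/negPn/negP => nxy.
have x1 : [set x] \subset V by rewrite sub1set.
have x0 : [set x] != set0 by apply/set0Pn; exists x; rewrite inE.
have xnV : [set x] != V by apply/eqP => E; move: V3; rewrite -E cards1.
have [s sN] := set0Pn _ (solid_conn sV x1 x0 xnV).
have s1 : [set s] \subset nb V [set x] by rewrite sub1set.
have st1 : stb [set s] by apply/stbP => a b /set1P-> /set1P->; rewrite e0.
have hN : [set x] :|: [set s] != V.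
  apply/eqP => E; have : #|V| <= 2 by rewrite -E cards2; case: (_ != _).
  by rewrite V3.
have cx : conn [set x] by move=> P; rewrite subset1 => /orP[]/eqP->; rewrite eqxx.
have := solid_degree sV x1 x0 cx s1 st1 hN; rewrite !cards1 ne1.
have yD : y \in V :\ x by rewrite !inE eq_sym xy.
have cV := cardsD1 x V; have cV' := cardsD1 y (V :\ x); rewrite xV V3 in cV; rewrite yD in cV'.
have := dd1_le x (V :\ x :\ y).
rewrite -{3}(setD1K yD) ddU1 ?(negPf nxy) ?add0n; last by rewrite !inE eqxx.
by move=> *; nlia.
Qed.

Lemma clqP C : reflect (clq C) [forall x in C, forall y in C, (x != y) ==> e x y].
Proof.
apply: (iffP idP) => [h x y xC yC|h].
  by apply: implyP; apply: (forall_inP (forall_inP h x xC)).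
apply/forall_inP => x xC; apply/forall_inP => y yC; apply/implyP; exact: h.
Qed.

Lemma unsplitVcut V : unsplit V \/
  exists Y, [/\ Y \subset V, Y != set0, clq (nb V Y) & Y :|: nb V Y != V].
Proof.
have [/existsP[Y /and4P[? ? /clqP ? ?]]|/existsPn h] := boolP [exists Y : {set T},
  [&& Y \subset V, Y != set0, [forall x in nb V Y, forall y in nb V Y, (x != y) ==> e x y]
    & Y :|: nb V Y != V]]; first by right; exists Y.
left=> Y sY Y0 /clqP cN; apply/eqP; have := h Y; rewrite sY Y0 cN /=.
by rewrite negbK.
Qed.

Definition gr U := graph_on U (fun s => [exists x, exists y, (s == [set x; y]) && e x y]).

Lemma adj_gr U x y : adj (gr U) x y = [&& x \in U, y \in U & e x y].
Proof.
rewrite /adj /= inE subUset !sub1set cards2 -andbA.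
case: (x \in U) => //=; case: (y \in U) => //=.
apply/idP/idP => [/andP[xy /existsP[a /existsP[b /andP[/eqP E ab]]]]|xy].
  have /set2P xab : x \in [set a; b] by rewrite -E set21.
  have /set2P yab : y \in [set a; b] by rewrite -E set22.
  by move: xy; case: xab => ->; case: yab => ->; rewrite ?eqxx // eC.
rewrite edge_neq //=; apply/existsP; exists x; apply/existsP; exists y.
by rewrite eqxx.
Qed.

Lemma Gsc_of_prism V x y z w p q : gadget V x y z w p q ->
  V = [set x; y; z] :|: [set w; p; q] ->
  e y p -> e z q -> ~~ e y q -> ~~ e z p -> Gsc (gr V).
Proof.
move=> g VE yp zq nyq nzp.
have [[xV yV zV wV [pV qV]] [[xy xz xw wp wq] [[yz pq nxy nxz nxw] [[nwp nwq nxp nxq npq]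
  [nyz nyw nzw [neyp neyq nezp nezq]]]]]] := gadgetE g.
have [un _ Nx Nw _] := g.
have [xp xq] : e x p = false /\ e x q = false.
  rewrite !Nx // !inE ![p == _]eq_sym ![q == _]eq_sym.
  by rewrite (negPf neyp) (negPf nezp) (negPf nwp) (negPf neyq) (negPf nezq) (negPf nwq).
have [wy wz] : e w y = false /\ e w z = false.
  rewrite !Nw // !inE ![_ == x]eq_sym.
  by rewrite (negPf nxy) (negPf neyp) (negPf neyq) (negPf nxz) (negPf nezp) (negPf nezq).
(* Around the 6-cycle of the complement: the triangles are the even and the odd places. *)
pose s := [:: x; q; y; w; z; p]; pose h (i : 'I_6) := nth x s i.
have us : uniq s by rewrite -(perm_uniq (_ : perm_eq [:: x; y; z; w; p; q] s)) //;
  apply/permP => a /=; clear; lia.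
have sV u : (u \in V) = (u \in s) by rewrite VE !inE; clear; lia.
have hV (i : 'I_6) : h i \in V by rewrite sV mem_nth.
apply: Gsc_iso Gsc_prism; apply: (@isomorphic_map _ _ _ _ h).
- move=> i j _ _ /eqP; rewrite nth_uniq // => /eqP; exact: val_inj.
- apply/setP => u; apply/imsetP/idP => [[i _ ->]//|]; rewrite sV => us'.
  have lt : index u s < 6 by rewrite -[6]/(size s) index_mem.
  by exists (Ordinal lt); rewrite // /h /= nth_index.
move=> i j _ _; rewrite adj_gr !hV adj_prism.
case: i j => [[|[|[|[|[|[|//]]]]]] hi] [[|[|[|[|[|[|//]]]]]] hj]; rewrite /h /s /=;
  rewrite ?e0 ?xy ?xz ?xw ?yz ?yp ?zq ?wp ?wq ?pq ?xp ?xq ?wy ?wz ?(negPf nyq) ?(negPf nzp) //;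
  by rewrite eC ?xy ?xz ?xw ?yz ?yp ?zq ?wp ?wq ?pq ?xp ?xq ?wy ?wz ?(negPf nyq) ?(negPf nzp).
Qed.

Lemma Gsc_of_gadget V x y z w p q : solid V -> ne V + 3 <= 2 * #|V| -> unsplit V ->
  4 <= #|V| -> gadget V x y z w p q -> Gsc (gr V).
Proof.
move=> sV hV uV V4; wlog yp : x y z w p q / e y p => [IH g|g].
  have gl := gadget_swapl g; have gr' := gadget_swapr g; have glr := gadget_swapl gr'.
  by have /or4P[] := gadget_crossed sV hV uV V4 g => h;
    [apply: IH h g|apply: IH h gr'|apply: IH h gl|apply: IH h glr].
have [VE zq nyq nzp] := gadget_prism sV hV uV V4 g yp.
exact: (Gsc_of_prism g VE).
Qed.

Lemma solid_Gsc V : solid V -> ne V + 3 <= 2 * #|V| -> 3 <= #|V| -> Gsc (gr V).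
Proof.
have [n] := ubnP #|V|; elim: n V => // n IH V ltV sV hV V3.
have [V4|V3'] := leqP 4 #|V|; last first.
  have cV : #|V| = 3 by nlia.
  apply: Gsc_iso Gsc_K3; apply: isomorphic_complete => // x y xV yV.
  rewrite adj_gr xV yV /=; have [->|xy] := eqVneq x y; first exact: e0.
  exact: (solid_triangle sV cV).
have [uV|[Y [sY Y0 cN YNV]]] := unsplitVcut V.
  have [x [y [z [w [p [q g]]]]]] := gadget_exists sV hV uV V4.
  exact: (Gsc_of_gadget sV hV uV V4 g).
set C := nb V Y in cN YNV.
have sC : C \subset V := nbS _ _.
have dYC : [disjoint Y & C] := nb_disj _ _.
pose A := Y :|: C; pose B := V :\: Y.
have sA : A \subset V by rewrite subUset sY.
have pA : A \proper V by rewrite properEneq YNV.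
have pB : B \proper V.
  rewrite properE subsetDl; apply/subsetPn; have [y yY] := set0Pn _ Y0.
  by exists y; rewrite ?(subsetP sY) // inE yY.
have CB : C \subset B.
  by apply/subsetP => c cC; rewrite inE (subsetP sC) // andbT (disjointFl dYC cC).
have noYC : {in Y & V :\: A, forall x y, ~~ e x y}.
  move=> x y xY /setDP[yV]; rewrite in_setU negb_or => /andP[yY yC].
  by apply: contra yC => xy; apply/nbP; split=> //; exists x.
have solA : solid A.
  apply: (solid_piece sV pA cN) => x y; rewrite in_setD in_setU => /andP[/negPf-> xY].
  by apply: noYC; rewrite orbF in xY.
have solB : solid B.
  apply: (solid_piece sV pB cN) => x y /setDP[/setDP[xV xY] xC] /setDP[yV].
  rewrite in_setD yV andbT negbK => yY; rewrite eC; apply: noYC => //.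
  by rewrite in_setD in_setU xV andbT negb_or xY.
(* A separating clique with fewer than two vertices would be a stable cutset; with [C3] this leaves
   the two sizes allowed for gluing. *)
have C2 : 2 <= #|C|.
  rewrite leqNgt; apply/negP => C1; case/eqP: YNV; apply: sV => //.
  by rewrite stb_ne ne_small.
have C3 := clq_small sV hV sC cN.
have Yp : 0 < #|Y| by rewrite card_gt0.
have cA : #|A| = #|Y| + #|C| by rewrite cardU.
have cB : #|C| < #|B|.
  apply: proper_card; rewrite properEneq CB andbT; apply: contraNneq YNV => E.
  by rewrite E /B -{2}(setID V Y) (setIidPr sY).
have ltA := proper_card pA; have ltB := proper_card pB.
have GA : Gsc (gr A).
  by apply: IH => //; [|apply: (sparse sV hV)|]; rewrite ?cA //; nlia.
have GB : Gsc (gr B).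
  by apply: IH => //; [|apply: (sparse sV hV); first exact: proper_sub|]; nlia.
have inY x : x \in V -> x \notin C -> x \in Y \/ x \in B.
  by move=> xV xC; rewrite /B in_setD xV; case: (x \in Y); [left|right].
have memA x : (x \in A) = (x \in Y) || (x \in C) by rewrite in_setU.
have memB x : (x \in B) = (x \notin Y) && (x \in V) by rewrite in_setD.
have interE : A :&: B = C.
  apply/setP => x; rewrite in_setI memA memB; have [xY|xY] := boolP (x \in Y).
    by rewrite andbF (disjointFr dYC xY).
  by case xC: (x \in C); rewrite //= (subsetP sC x xC).
have GU : Gsc (union (gr A) (gr B)).
  apply: Gsc_union => //.
  have adjC : {in vertices (inter (gr A) (gr B)) &, forall x y,
      adj (inter (gr A) (gr B)) x y = (x != y)}.
    move=> x y; rewrite /= -/A -/B interE => xC yC.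
    have -> : adj (inter (gr A) (gr B)) x y = adj (gr A) x y && adj (gr B) x y.
      by rewrite /adj /= inE.
    rewrite !adj_gr !memA xC yC !orbT (subsetP CB x xC) (subsetP CB y yC) /= andbb.
    by have [->|xy] := eqVneq x y; [exact: e0|exact: cN].
  have cI k : #|C| = k -> isomorphic (inter (gr A) (gr B)) (complete k).
    move=> cC; apply/isomorphic_sym/isomorphic_complete => //.
    by rewrite /= -/A -/B interE.
  have [C2'|C3'] : #|C| = 2 \/ #|C| = 3 by nlia.
    by left; apply: cI.
  by right; apply: cI.
apply: Gsc_iso GU; apply: isomorphic_eq => [/=|x y _ _].
  apply/setP => x; rewrite in_setU memA memB; case xY: (x \in Y) => /=.
    by rewrite (subsetP sY).
  by case xC: (x \in C); rewrite //= (subsetP sC).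
have -> : adj (union (gr A) (gr B)) x y = adj (gr A) x y || adj (gr B) x y.
  by rewrite /adj /= inE.
rewrite !adj_gr; case xy: (e x y); rewrite ?andbF // !andbT.
have [xV|xV] := boolP (x \in V); last first.
  by rewrite (contraNF (subsetP sA x) xV) (contraNF (subsetP (proper_sub pB) x) xV).
have [yV|yV] := boolP (y \in V); last first.
  by rewrite (contraNF (subsetP sA y) yV) (contraNF (subsetP (proper_sub pB) y) yV) !andbF.
have cl a b : a \in Y -> b \in V -> e a b -> b \in A.
  move=> aY bV ab; apply/negPn/negP => bA; have := noYC a b aY.
  by rewrite in_setD bA bV ab => /(_ isT).
rewrite !memB xV yV !andbT; apply/esym; have [xY|xY] := boolP (x \in Y).
  by rewrite (cl x y) // memA xY.
rewrite /=; have [yY|yY] := boolP (y \in Y); last by rewrite orbT.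
by rewrite (cl y x) ?(eC y) // memA yY.
Qed.

End EdgeCounts.

(** * From graphs to adjacency relations *)

Section OfGraph.
Variables (T : finType) (G : graph T).

Lemma adj_sym : symmetric (adj G).
Proof. by move=> x y; rewrite /adj /= setUC. Qed.

Lemma adj_irr : irreflexive (adj G).
Proof.
by move=> x; apply/negP => /edgesP[_]; rewrite cards2 eqxx.
Qed.

Lemma adj_vertices x y : adj G x y -> x \in vertices G /\ y \in vertices G.
Proof. by move=> /edgesP[/subsetP s _]; split; apply: s; rewrite ?set21 ?set22. Qed.

Lemma card_edges : #|edges G| = ne (adj G) (vertices G).
Proof.
suff : dd (adj G) (vertices G) (vertices G) = 2 * #|edges G|.
  by rewrite (dd_even adj_sym adj_irr); lia.
rewrite /dd pair_big_dep /=.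
rewrite mulnC -sum_nat_const.
(* Ordered pairs are grouped by the set of their entries: each edge receives two adjacent pairs, any
   other set none. *)
rewrite (partition_big (fun u : T * T => [set u.1; u.2]) predT) //=.
rewrite [RHS]big_mkcond /=; apply: eq_bigr => E _.
have [EG|EG] := boolP (E \in edges G); last first.
  rewrite big1 // => u /andP[_ /eqP uE].
  by case: (boolP (adj G u.1 u.2)) => //; rewrite /adj /= uE (negPf EG).
have [/subsetP sE /eqP/cards2P[a [b [ab Eab]]]] := edgesP EG.
have [aV bV] : a \in vertices G /\ b \in vertices G.
  by split; apply: sE; rewrite Eab ?set21 ?set22.
rewrite (eq_bigl (fun u => u \in [set (a, b); (b, a)])).
  rewrite big_setU1 ?big_set1 /=; last by rewrite inE xpair_eqE negb_and ab.
  by rewrite adj_sym /adj /= setUC -Eab EG.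
move=> [u v]; rewrite !inE /= !xpair_eqE; apply/andP/idP => [[_ /eqP uv]|].
  have /set2P uab : u \in [set a; b] by rewrite -Eab -uv set21.
  have /set2P vab : v \in [set a; b] by rewrite -Eab -uv set22.
  case: uab vab uv => -> [] ->; rewrite ?eqxx ?orbT // setUid Eab => /setP.
    by move=> /(_ b); rewrite !inE eqxx orbT eq_sym (negPf ab).
  by move=> /(_ a); rewrite !inE eqxx (negPf ab).
by case/orP=> /andP[/eqP-> /eqP->]; rewrite aV bV Eab ?eqxx // setUC eqxx.
Qed.

Lemma stable_cutset_of (Q : {set T}) : Q \subset vertices G -> Q != set0 ->
    stb (adj G) (nb (adj G) (vertices G) Q) ->
    Q :|: nb (adj G) (vertices G) Q != vertices G ->
  stable_cutset G (nb (adj G) (vertices G) Q).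
Proof.
set V := vertices G; set S := nb _ _ _ => sQ Q0 stS nV; split.
  by split; [exact: nbS|exact/stbP].
have [q qQ] := set0Pn _ Q0.
have /subsetPn[v vV vQS] : ~~ (V \subset Q :|: S).
  by apply: contra nV => s; rewrite eqEsubset s subUset sQ nbS.
have [vQ vS] : v \notin Q /\ v \notin S by apply/andP; rewrite -negb_or -in_setU.
have qS : q \notin S by rewrite (disjointFr (nb_disj _ _ _) qQ).
move=> cG; have /cG : q \in vertices (delete G S) by rewrite inE qS (subsetP sQ).
move=> /(_ v); rewrite inE vS vV => /(_ isT).
have out x y : x \in Q -> adj (delete G S) x y -> y \in Q.
  move=> xQ; rewrite /adj /= inE subUset !sub1set => /and3P[/andP[_]].
  rewrite inE => /andP[yS yV] _ xy; apply: contraNT yS => yQ.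
  by apply/nbP; split=> //; exists x.
(* [Q] loses all its outside neighbours with [S], so no path of [delete G S] leads from [q] to
   [v]. *)
have cl : closed (adj (delete G S)) Q.
  move=> x y xy; apply/idP/idP => [xQ|yQ]; first exact: out xy.
  by apply: (out y) => //; move: xy; rewrite /adj /= setUC.
by move=> /(closed_connect cl); rewrite qQ (negPf vQ).
Qed.

End OfGraph.

(* The bound |E| <= 2n - 3 is written without truncated subtraction.  K_2 is
   excluded: it has 1 = 2 * 2 - 3 edge and no stable cutset, and every member
   of the class has at least three vertices. *)
Theorem theorem4 (T : finType) (G : graph T)
  (hG : ~ isomorphic G (complete 2))
  (hE : #|edges G| + 3 <= 2 * #|vertices G|) :
  (exists S : {set T}, stable_cutset G S) \/ Gsc G.
Proof.
set V := vertices G in hE *.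
have [/existsP[Q /and4P[sQ Q0 stQ nV]]|/existsPn h] := boolP [exists Q : {set T},
    [&& Q \subset V, Q != set0, stb (adj G) (nb (adj G) V Q) & Q :|: nb (adj G) V Q != V]].
  by left; exists (nb (adj G) V Q); apply: stable_cutset_of.
right; have sV : solid (adj G) V.
  move=> Q sQ Q0 stQ; apply/eqP; have := h Q; rewrite sQ Q0 stQ /=.
  by rewrite negbK.
have [eC e0] := (@adj_sym _ G, @adj_irr _ G).
rewrite (card_edges G) -/V in hE.
have isoG : isomorphic (gr (adj G) V) G.
  apply: isomorphic_eq => // x y _ _; rewrite (adj_gr eC e0).
  case xy: (adj G x y); last by rewrite !andbF.
  by have [xV yV] := adj_vertices xy; rewrite /V xV yV.
have [V3|V2] := leqP 3 #|V|; first exact: Gsc_iso isoG (solid_Gsc eC e0 sV hE V3).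
(* The edge bound forces at least two vertices, hence exactly two here, and they are adjacent
   because a solid graph is connected. *)
case: hG; apply/isomorphic_sym/isomorphic_complete; first by rewrite -/V; lia.
have c2 : #|V| = 2 by lia.
move=> x y; rewrite -/V => xV yV; have [->|xy] := eqVneq x y; first exact: e0.
have EV : [set x; y] = V.
  by apply/eqP; rewrite eqEcard c2 cards2 xy subUset !sub1set xV yV.
have x1 : [set x] \subset V by rewrite sub1set.
have x0 : [set x] != set0 by apply/set0Pn; exists x; rewrite inE.
have xnV : [set x] != V by apply/eqP => E; move: c2; rewrite -E cards1.
have [s /nbP[sV' sx [a /set1P-> xs]]] := set0Pn _ (solid_conn sV x1 x0 xnV).
by move: sV' sx xs; rewrite -EV !inE => /orP[]/eqP->; rewrite ?eqxx.
Qed.
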